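(* Let $\alpha$ be a regular $C^2$ curve in $\mathbb{S}^{m+1}(r)$ or $\mathbb{H}^{m+1}(r)$, and let $\kappa_1,\dots,\kappa_m$ be the curvatures associated with a rotation minimizing frame along $\alpha$. Then $\alpha$ lies on a geodesic sphere if and only if $$\sum_{i=1}^m a_i\,\kappa_i+\frac{1}{r}\cot\left(\frac{z_0}{r}\right)=0\quad\text{if } \alpha\subseteq\mathbb{S}^{m+1}(r),$$ $$\sum_{i=1}^m a_i\,\kappa_i+\frac{1}{r}\coth\left(\frac{z_0}{r}\right)=0\quad\text{if } \alpha\subseteq\mathbb{H}^{m+1}(r),$$ for some constants $z_0$ (the radius of the geodesic sphere) and $a_i$, $1\le i\le m$. (For $\mathbb{S}^{m+1}(r)$ one may impose $z_0<\pi r/2$, which guarantees that the center of the geodesic sphere is well defined: if $z_0=\pi r/2$, both the center $p$ and its antipodal point $-p$ are equidistant from the geodesic sphere.)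
   Context: $\mathbb{S}^{m+1}(r)=\{q\in\mathbb{R}^{m+2}:\langle q,q\rangle_e=r^2\}$ is the sphere of radius $r$, with the metric induced by the Euclidean inner product $\langle\cdot,\cdot\rangle_e$. $\mathbb{H}^{m+1}(r)=\{q\in\mathbb{R}^{m+2}:\langle q,q\rangle_1=-r^2,\ x_1>0\}$ is the hyperbolic space of radius $r$, with the metric induced by $\langle x,y\rangle_1=-x_1y_1+\sum_{i=2}^{m+2}x_iy_i$. Let $M$ denote either of these spaces and $\nabla$ its Levi-Civita connection. For a regular curve $\alpha:I\to M$ with arc-length parameter $s$ and unit tangent $\mathbf{t}=\alpha'$, a rotation minimizing (RM) frame along $\alpha$ is an orthonormal frame $\{\mathbf{t},\mathbf{n}_1,\dots,\mathbf{n}_m\}$ of $T_{\alpha(s)}M$ such that each $\nabla_{\mathbf{t}}\mathbf{n}_i$ is parallel to $\mathbf{t}$. Its equations of motion are $\nabla_{\mathbf{t}}\mathbf{t}=\sum_{i=1}^m\kappa_i\mathbf{n}_i$ and $\nabla_{\mathbf{t}}\mathbf{n}_i=-\kappa_i\mathbf{t}$ for $1\le i\le m$, and the functions $\kappa_i$ are its associated curvatures. The geodesic sphere of center $p\in M$ and radius $z_0$ is the set of points of $M$ at Riemannian distance $z_0$ from $p$.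
   Formalization: The a_i are constrained, as a horocycle refutes the literal converse: with sum a_i^2=1, z0 is the radius; for mere existence, a is nonzero on the sphere (no condition if z0<pi r/2) and |a|<coth(z0/r) in hyperbolic space; 0<z0 (<pi r on the sphere). *)

(* Defs.v *)
From HB Require Import structures.
From mathcomp Require Import all_boot all_order all_algebra.
From mathcomp Require Import all_classical all_reals all_analysis.
Import Order.TTheory GRing.Theory Num.Theory.
Import numFieldNormedType.Exports.

Set Implicit Arguments.
Unset Strict Implicit.
Unset Printing Implicit Defensive.

Local Open Scope ring_scope.
Local Open Scope classical_set_scope.

(* MathComp-Analysis development: points and vectors of R^(m+2) are row vectors
   'rV[R]_(m.+2), whose coordinate ord0 is the x_1 of the usual indexing. *)

Definition euclid_form (R : realType) (m : nat) (x y : 'rV[R]_(m.+2)) : R :=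
  \sum_(i < m.+2) x 0 i * y 0 i.

Definition lorentz_form (R : realType) (m : nat) (x y : 'rV[R]_(m.+2)) : R :=
  - (x 0 ord0 * y 0 ord0)
  + \sum_(i < m.+1) x 0 (lift ord0 i) * y 0 (lift ord0 i).

Definition sphere_space (R : realType) (m : nat) (r : R) : set 'rV[R]_(m.+2) :=
  [set q | euclid_form q q = r ^+ 2].

Definition hyperbolic_space (R : realType) (m : nat) (r : R) : set 'rV[R]_(m.+2) :=
  [set q | lorentz_form q q = - r ^+ 2 /\ 0 < q 0 ord0].

Definition cot (R : realType) (x : R) : R := cos x / sin x.

Definition coth (R : realType) (x : R) : R :=
  (expR x + expR (- x)) / (expR x - expR (- x)).

Section Geometry.
Variables (R : realType) (m : nat).
Local Notation V := 'rV[R]_(m.+2).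

(* [g] is the ambient bilinear form and [M] the hypersurface; they are used only
   with (euclid_form, sphere_space r) and (lorentz_form, hyperbolic_space r). *)
Variables (g : V -> V -> R) (M : set V).

(* [M] is open in a level set of q |-> g q q, so the tangent space at q is
   q^perp and the normal line is spanned by q. *)
Definition tangent_space (q : V) : set V := [set v | g v q = 0].

(* Covariant derivative along [alpha] of a vector field [X] tangent to [M], for
   the Levi-Civita connection of the metric induced by [g]: the g-orthogonal
   projection of the ambient derivative onto the tangent space (Gauss formula). *)
Definition cov_deriv (alpha X : R -> V) (s : R) : V :=
  derive1 X s - (g (derive1 X s) (alpha s) / g (alpha s) (alpha s)) *: alpha s.

(* If [I] contains an end point, [alpha] is meant as the restriction of a curve
   which is C2 on a neighbourhood of [I] (such an extension always exists in the
   ambient space); only its values on [I] are required to lie in [M].  The same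
   convention applies below to the derivatives of the fields n_i along [alpha]. *)
Definition C2_on (I : set R) (alpha : R -> V) : Prop :=
  (forall s, I s -> derivable alpha s 1 /\ derivable (derive1 alpha) s 1) /\
  {within I, continuous (derive1n 2 alpha)}.

(* Regular C2 curve of [M] parametrized by arc length. *)
Definition arc_length_curve (I : set R) (alpha : R -> V) : Prop :=
  [/\ C2_on I alpha, forall s, I s -> M (alpha s)
    & forall s, I s -> g (derive1 alpha s) (derive1 alpha s) = 1].

(* {t, n_1, ..., n_m} has m+1 = dim M members, so orthonormality already makes
   it a basis of the tangent space. *)
Definition orthonormal_frame (I : set R) (alpha : R -> V)
    (n : 'I_m -> R -> V) : Prop :=
  forall s, I s ->
  [/\ forall i, tangent_space (alpha s) (n i s),
      forall i, g (n i s) (derive1 alpha s) = 0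
    & forall i j, g (n i s) (n j s) = (i == j)%:R].

Definition RM_frame (I : set R) (alpha : R -> V) (n : 'I_m -> R -> V) : Prop :=
  orthonormal_frame I alpha n /\
  forall i s, I s ->
    derivable (n i) s 1 /\
    exists c : R, cov_deriv alpha (n i) s = c *: derive1 alpha s.

Definition RM_curvatures (I : set R) (alpha : R -> V) (n : 'I_m -> R -> V)
    (kappa : 'I_m -> R -> R) : Prop :=
  forall s, I s ->
    cov_deriv alpha (derive1 alpha) s = \sum_(i < m) kappa i s *: n i s /\
    forall i, cov_deriv alpha (n i) s = - kappa i s *: derive1 alpha s.

Definition curve_length (gamma : R -> V) : R :=
  \int[lebesgue_measure]_(t in `[0, 1])
    Num.sqrt (g (derive1 gamma t) (derive1 gamma t)).

(* [piecewise_C1_length p q l]: some piecewise C1 curve of [M] from p to q has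
   length l.  A C1 curve on [0, 1] is given by a C1 extension to R, which is
   required to lie in [M] on [0, 1] only. *)
Inductive piecewise_C1_length : V -> V -> R -> Prop :=
| C1_piece (gamma : R -> V) :
    (forall t, derivable gamma t 1) -> continuous (derive1 gamma) ->
    (forall t, 0 <= t <= 1 -> M (gamma t)) ->
    piecewise_C1_length (gamma 0) (gamma 1) (curve_length gamma)
| C1_concat (p q w : V) (l l' : R) :
    piecewise_C1_length p q l -> piecewise_C1_length q w l' ->
    piecewise_C1_length p w (l + l').

Definition riem_dist (p q : V) : \bar R :=
  ereal_inf [set l%:E | l in [set l | piecewise_C1_length p q l]].

Definition geodesic_sphere (p : V) (z0 : R) : set V :=
  [set q | M q /\ riem_dist p q = z0%:E].

Definition lies_on_geodesic_sphere (I : set R) (alpha : R -> V) (z0 : R) : Prop :=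
  exists2 p, M p & forall s, I s -> geodesic_sphere p z0 (alpha s).

End Geometry.

(* Interval with more than one point; it need be neither open nor closed. *)
Definition nondegenerate_interval (R : realType) (I : set R) : Prop :=
  is_interval I /\ exists x y, [/\ I x, I y & x < y].

(* Main.v *)
Require Import Defs.
From HB Require Import structures.
From mathcomp Require Import all_boot all_order all_algebra.
From mathcomp Require Import all_classical all_reals all_analysis.
From mathcomp Require Import ring lra.
Import Order.TTheory GRing.Theory Num.Theory.
Import numFieldNormedType.Exports.
Local Open Scope ring_scope.
Local Open Scope classical_set_scope.

(** Both spaces are quadrics [g q q = e * r ^+ 2] of a diagonal form [g] of
    signature [(e, 1, ..., 1)], with [e = 1] or [e = -1], and [cos, sin] and
    [cosh, sinh] play the same role for them.  Almost everything is therefore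
    proved once, for a space described by the record [space_form] with a pair
    of functions [C, S].

    The distance.  The statement speaks of the infimum of the lengths of curves,
    so a geodesic sphere must first be recognized as a hyperplane section:
    [riem_dist p q = z0] if and only if [z0 / r] is an admissible angle and
    [g p q = e * r ^+ 2 * C (z0 / r)] ([riem_dist_eqP]).  The curve
    [C t *: p + (r * S t) *: u] realizes the distance.  Conversely, along a C1
    curve the angle to a fixed point varies at most as fast as the arc length,
    since Cauchy-Schwarz in the tangent space bounds the derivative of its
    cosine [c] by the speed times the square root of [e * (1 - c ^+ 2)], divided
    by [r].  The inverse function of [C] has a singular derivative where [c] is
    [1] or [-1]; scaling the cosine by a factor [k] that tends to [1] keeps it
    away from there ([scaled_increment]) and the bound survives in the limit
    ([form_angle_increment]).  The bound is additive over concatenations, so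
    piecewise C1 curves need no triangle inequality.

    The curve.  If [alpha] lies in the section of centre [p], then [p] is
    orthogonal to [alpha'], and since each [n i] has derivative parallel to
    [alpha'], the components [b i = g p (n i)] are constant.  Differentiating
    [g p alpha' = 0] yields [\sum_i b i * kappa i = C (z0 / r)], and Parseval's
    identity in the frame [alpha, alpha', n] gives
    [\sum_i b i ^+ 2 = r ^+ 2 * S (z0 / r) ^+ 2]: this is the relation, with
    [a i = - b i / (r * S (z0 / r))] of norm one ([center_relation]).
    Conversely, the relation says precisely that the point
    [C (z0 / r) *: alpha - (r * S (z0 / r)) *: \sum_i a i *: n i] has zero
    derivative; it is the centre ([relation_center]).  When [a] is not
    normalized, dividing by its norm changes the cotangent of the radius
    ([relation_on_geodesic_sphere]); every real number is a cotangent, but a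
    hyperbolic cotangent of a positive number must exceed [1], whence the
    condition on the norm of [a] in the hyperbolic case. *)

(** * Diagonal bilinear forms *)

Section DiagonalForm.
Context {R : realType} {k : nat}.
Local Notation V := 'rV[R]_k.
Implicit Types (w : 'I_k -> R) (x y z : V).

Definition wform w x y : R := \sum_(i < k) w i * (x 0 i * y 0 i).

Lemma wformC w x y : wform w x y = wform w y x.
Proof. by apply: eq_bigr => i _; rewrite (mulrC (x 0 i)). Qed.

Lemma wformDl w x y z : wform w (x + y) z = wform w x z + wform w y z.
Proof. by rewrite -big_split; apply: eq_bigr => i _; rewrite mxE mulrDl mulrDr. Qed.

Lemma wformZl w c x z : wform w (c *: x) z = c * wform w x z.
Proof. by rewrite mulr_sumr; apply: eq_bigr => i _; rewrite mxE; ring. Qed.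

Lemma wformNl w x z : wform w (- x) z = - wform w x z.
Proof. by rewrite -scaleN1r wformZl mulN1r. Qed.

Lemma wformBl w x y z : wform w (x - y) z = wform w x z - wform w y z.
Proof. by rewrite wformDl wformNl. Qed.

Lemma wform0l w z : wform w 0 z = 0.
Proof. by rewrite -(scale0r 0) wformZl mul0r. Qed.

Lemma wform_suml w (J : finType) (F : J -> V) z :
  wform w (\sum_j F j) z = \sum_j wform w (F j) z.
Proof.
by apply: (big_morph (fun x => wform w x z)) => [x y|]; rewrite ?wformDl ?wform0l.
Qed.

Lemma wformDr w x y z : wform w z (x + y) = wform w z x + wform w z y.
Proof. by rewrite !(wformC w z) wformDl. Qed.

Lemma wformZr w c x z : wform w z (c *: x) = c * wform w z x.
Proof. by rewrite !(wformC w z) wformZl. Qed.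

Lemma wformNr w x z : wform w z (- x) = - wform w z x.
Proof. by rewrite !(wformC w z) wformNl. Qed.

Lemma wformBr w x y z : wform w z (x - y) = wform w z x - wform w z y.
Proof. by rewrite !(wformC w z) wformBl. Qed.

Lemma wform0r w z : wform w z 0 = 0.
Proof. by rewrite wformC wform0l. Qed.

Lemma wform_sumr w (J : finType) (F : J -> V) z :
  wform w z (\sum_j F j) = \sum_j wform w z (F j).
Proof. by rewrite wformC wform_suml; apply: eq_bigr => j _; rewrite wformC. Qed.

Definition wformE := (wformDl, wformDr, wformBl, wformBr, wformNl, wformNr,
  wformZl, wformZr, wform0l, wform0r).

(** The Gram matrix of the family is invertible, hence so is the matrix whose
    rows are its members; its one-sided inverse is then two-sided, and the second
    of the two products is the expansion. *)
Lemma orthogonal_expansion w (e : 'I_k -> V) :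
  (forall i, wform w (e i) (e i) != 0) ->
  (forall i j, i != j -> wform w (e i) (e j) = 0) ->
  forall x, x = \sum_i (wform w x (e i) / wform w (e i) (e i)) *: e i.
Proof.
move=> e0 eo x.
pose N : 'M[R]_k := \matrix_i e i.
pose D : 'M[R]_k := \matrix_(l, i) (w l * e i 0 l / wform w (e i) (e i)).
have ND : N *m D = 1%:M.
  apply/matrixP => i j; rewrite !mxE.
  rewrite (eq_bigr (fun l => w l * (e i 0 l * e j 0 l) / wform w (e j) (e j)));
    last by move=> l _; rewrite !mxE; ring.
  rewrite -mulr_suml -/(wform w (e i) (e j)).
  by have [->|/eo ->] := eqVneq i j; rewrite ?divff// mul0r.
rewrite -[LHS]mulmx1 -(mulmx1C ND) mulmxA mulmx_sum_row; apply: eq_bigr => i _.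
rewrite rowK; congr (_ *: _); rewrite mxE /wform mulr_suml.
by apply: eq_bigr => l _; rewrite mxE; ring.
Qed.

End DiagonalForm.

(** * Calculus along an interval *)

Section DeriveForm.
Context {R : realType} {k : nat}.
Local Notation V := 'rV[R]_k.+1.
Implicit Types (w : 'I_k.+1 -> R).

Lemma is_derive_coord {X : R -> V} {s : R} {dX : V} i :
  is_derive s 1 X dX -> is_derive s 1 (fun t => X t 0 i) (dX 0 i).
Proof.
move=> [dvX <-]; split; first by move/derivable_mxP: dvX.
by rewrite derive_mx// mxE.
Qed.

Lemma is_derive_row {X : R -> V} {s : R} {dX : V} :
  (forall i, is_derive s 1 (fun t => X t 0 i) (dX 0 i)) -> is_derive s 1 X dX.
Proof.
move=> dX'.
have dvX : derivable X s 1 by apply/derivable_mxP => i j; rewrite ord1; have [] := dX' j.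
split=> //; rewrite derive_mx//; apply/rowP => i; rewrite mxE.
by have [_ ->] := dX' i.
Qed.

Lemma is_derive_scale {a : R -> R} {s da : R} (x : V) :
  is_derive s 1 a da -> is_derive s 1 (fun t => a t *: x) (da *: x).
Proof.
move=> dva; apply: is_derive_row => i.
rewrite (_ : (fun _ => _) = x 0 i \*: a); last first.
  by apply/funext => t; rewrite mxE mulrC.
by apply: is_derive_eq (is_deriveZ (x 0 i) dva) _; rewrite mxE mulrC.
Qed.

Lemma is_derive_wform w {X Y : R -> V} {s : R} {dX dY : V} :
  is_derive s 1 X dX -> is_derive s 1 Y dY ->
  is_derive s 1 (fun t => wform w (X t) (Y t)) (wform w dX (Y s) + wform w (X s) dY).
Proof.
move=> dvX dvY.
have dc i : is_derive s 1 (fun t => w i * (X t 0 i * Y t 0 i))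
    (w i * (dX 0 i * Y s 0 i + X s 0 i * dY 0 i)).
  have dXi := is_derive_coord i dvX; have dYi := is_derive_coord i dvY.
  have h := is_deriveZ (w i) (is_deriveM dXi dYi).
  apply: is_derive_eq h _; rewrite /GRing.scale/=; ring.
have := @is_derive_sum R R R^o _ (fun i t => w i * (X t 0 i * Y t 0 i)) s 1 _ dc.
rewrite (_ : \sum_(i < _) _ = (fun t => wform w (X t) (Y t))); last first.
  by apply/funext => t; rewrite fct_sumE.
move=> h; apply: is_derive_eq h _; rewrite /wform -big_split; apply: eq_bigr => i _.
by rewrite /=; ring.
Qed.

Lemma continuous_wform w (X Y : R -> V) :
  continuous X -> continuous Y -> continuous (fun t => wform w (X t) (Y t)).
Proof.
move=> cX cY; apply: continuous_big => [|i _ t]; first exact: add_continuous.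
apply: cvgM; first exact: cvg_cst.
have cc (Z : R -> V) : continuous Z -> {for t, continuous (fun t => Z t 0 i)}.
  move=> cZ; apply: (@continuous_comp _ _ _ Z (fun M : V => M 0 i)); first exact: cZ.
  exact: coord_continuous.
by apply: cvgM; exact: cc.
Qed.

End DeriveForm.

Section Interval.
Context {R : realType}.
Implicit Types (I : set R) (f : R -> R).

(** At an end point of [I] only one side of the difference quotient is known to
    vanish, but its two-sided limit exists, so this side determines it. *)
Lemma derive_cst_on {I f} {c s d : R} : nondegenerate_interval I ->
  I s -> (forall t, I t -> f t = c) -> is_derive s 1 f d -> d = 0.
Proof.
move=> [Iitv [x [y [Ix Iy xy]]]] Is fc [dvf fE].
have [z [Iz zs]] : exists z, I z /\ z != s.
  by have [xs|?] := eqVneq x s; [exists y; split=> //; rewrite -xs gt_eqF|exists x].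
apply/eqP/negPn/negP => d0.
move: dvf => /cvg_ex[/= l fl].
have ld : l = d by rewrite -fE; apply/esym/cvg_lim.
move/cvgrPdist_lt : fl => /(_ `|d|) /[!normr_gt0] /(_ d0)[/= e e0 He].
(* [h] points from [s] towards [z], stays in [I] because of the factor 1 and
   is shorter than [e] because of the other one. *)
pose h := Num.min 1 (e / 2 / `|z - s|) * (z - s).
have zs0 : 0 < `|z - s| by rewrite normr_gt0 subr_eq0.
have m0 : 0 < Num.min 1 (e / 2 / `|z - s|) by rewrite lt_min ltr01/= !divr_gt0.
have m1 : Num.min 1 (e / 2 / `|z - s|) <= 1 by rewrite ge_min lexx.
have h0 : h != 0 by rewrite mulf_neq0 ?(gt_eqF m0)// subr_eq0.
have he : `|h| < e.
  rewrite normrM gtr0_norm// (@le_lt_trans _ _ (e / 2))//; last by lra.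
  by rewrite -ler_pdivlMr// ge_min lexx orbT.
have Ih : I (h + s).
  move: m0 m1; rewrite {he h0}/h; set c' := Num.min _ _ => m0 m1.
  have [zls|szl] := ltP z s.
    by apply: (Iitv _ _ Iz Is); apply/andP; split; nra.
  by apply: (Iitv _ _ Is Iz); apply/andP; split; nra.
have := He h; rewrite /ball_/= sub0r normrN => /(_ he h0).
by rewrite [h%:A]mulr1 !fc// subrr scaler0 subr0 ld ltxx.
Qed.

Lemma derive0_cst_on {I f} : is_interval I ->
  (forall s, I s -> is_derive s 1 f 0) -> forall s t, I s -> I t -> f s = f t.
Proof.
move=> Iitv df s t.
wlog st : s t / s <= t => [H Is It|Is It].
  by case/orP: (le_total s t) => h; [|apply/esym]; exact: H.
have sub x : x \in `[s, t]%R -> I x by rewrite in_itv/=; exact: Iitv.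
have [||c _] := @MVT_segment R f (fun=> 0) s t st.
- by move=> x xst; apply/df/sub; move: x xst; apply/subset_itvW.
- by apply: derivable_within_continuous => x /sub/df[].
- by rewrite mul0r => /subr0_eq.
Qed.

End Interval.

(** The mean value theorem is applied to the integral of [v] minus [f], so that
    [df] need not be continuous or integrable. *)
Lemma increment_le_Rintegral {R : realType} (f df v : R -> R) :
  (forall t : R, 0 <= t <= 1 -> is_derive t 1 f (df t)) -> continuous v ->
  (forall t : R, 0 <= t <= 1 -> df t <= v t) ->
  f 1 - f 0 <= \int[lebesgue_measure]_(t in `[0, 1]) v t.
Proof.
move=> dvf cv dfv.
pose F x := \int[lebesgue_measure]_(t in `[0, x]) v t.
have iv : lebesgue_measure.-integrable `[0, 1] (EFin \o v).
  apply: continuous_compact_integrable; first exact: segment_compact.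
  exact: continuous_subspaceT.
have cF : {within `[0, 1], continuous F}.
  by apply: parameterized_integral_continuous => //; exact: ler01.
have cf : {within `[0, 1], continuous f}.
  by apply: derivable_within_continuous => x; rewrite in_itv/= => /dvf[].
have dF (x : R) : x \in `]0, 1[%R -> is_derive x 1 (F \- f) (v x - df x).
  rewrite in_itv/= => /andP[x0 x1].
  have [dF1 dF2] := @continuous_FTC1_closed R v 0 x 1 x1 iv x0 (cv x).
  have dFx : is_derive x 1 F (v x) by split => //; rewrite -derive1E.
  by apply: is_deriveB; apply: dvf; rewrite !ltW.
have cFf : {within `[0, 1], continuous (F \- f)}.
  by move=> x; apply: cvgB; [exact: cF|exact: cf].
have [c] := MVT ltr01 dF cFf; rewrite in_itv/= => /andP[c0 c1] /=.
have -> : F 0 = 0 by rewrite /F set_itv1 Rintegral_set1.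
have : 0 <= v c - df c by rewrite subr_ge0 dfv// !ltW.
rewrite /F; lra.
Qed.

Lemma nondegenerate_unit_itv {R : realType} :
  nondegenerate_interval [set t : R | 0 <= t <= 1].
Proof.
split; last by exists 0, 1; split; rewrite /= ?lexx ?ler01 ?ltr01.
move=> x y /= /andP[x0 _] /andP[_ y1] z /andP[xz zy].
by rewrite (le_trans x0)//= (le_trans zy).
Qed.

(** * Space forms *)

Definition signature {R : realType} {k : nat} (e : R) : 'I_k.+1 -> R :=
  fun i => if i == ord0 then e else 1.

(** What the sphere ([e = 1], with [cos], [sin], [acos] and angles in [[0, pi]])
    and hyperbolic space ([e = -1], with [cosh], [sinh], [arcosh] and nonnegative
    angles) have in common.  The alternative [0 < _ \/ e = 1] expresses the
    choice of one sheet of the hyperboloid, or of one branch of the hyperbola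
    [c ^+ 2 - s ^+ 2 = 1], and holds trivially for the sphere.  [A] is inverse
    to [C] on the angles [Theta]; since the angles [0] and [pi] are allowed, it
    is required to be differentiable only where [S] is positive, and continuous
    elsewhere. *)
Record space_form {R : realType} {m : nat} (r e : R) (M : set 'rV[R]_m.+2)
    (C S A : R -> R) (Theta : set R) : Prop := SpaceForm {
  sf_sign : e = 1 \/ e = -1;
  sf_sheet : forall p q, M q ->
    M p <-> wform (signature e) p p = e * r ^+ 2 /\
            (0 < e * wform (signature e) p q \/ e = 1);
  sf_tangent : forall q v, M q -> wform (signature e) q v = 0 -> v != 0 ->
    0 < wform (signature e) v v;
  sf_unit : forall q, M q -> exists u,
    wform (signature e) q u = 0 /\ wform (signature e) u u = 1;
  sf_C0 : C 0 = 1;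
  sf_derC : forall t : R, is_derive t 1 C (- e * S t);
  sf_derS : forall t : R, is_derive t 1 S (C t);
  sf_pythagoras : forall t : R, C t ^+ 2 + e * S t ^+ 2 = 1;
  sf_C_gt0 : forall t : R, 0 < C t \/ e = 1;
  sf_Theta0 : Theta 0;
  sf_Theta_ge0 : forall t : R, Theta t -> 0 <= t;
  sf_S_ge0 : forall t : R, Theta t -> 0 <= S t;
  sf_polar : forall c s, c ^+ 2 + e * s ^+ 2 = 1 -> 0 <= s -> 0 < c \/ e = 1 ->
    exists t, [/\ Theta t, C t = c & S t = s];
  sf_CK : {in Theta, cancel C A};
  sf_A_cont : {within C @` Theta, continuous A};
  sf_derA : forall t : R, Theta t -> 0 < S t -> is_derive (C t) 1 A (- e / S t)
}.

Arguments sf_sign {R m r e M C S A Theta}.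
Arguments sf_sheet {R m r e M C S A Theta}.
Arguments sf_tangent {R m r e M C S A Theta}.
Arguments sf_unit {R m r e M C S A Theta}.
Arguments sf_C0 {R m r e M C S A Theta}.
Arguments sf_derC {R m r e M C S A Theta}.
Arguments sf_derS {R m r e M C S A Theta}.
Arguments sf_pythagoras {R m r e M C S A Theta}.
Arguments sf_C_gt0 {R m r e M C S A Theta}.
Arguments sf_Theta0 {R m r e M C S A Theta}.
Arguments sf_Theta_ge0 {R m r e M C S A Theta}.
Arguments sf_S_ge0 {R m r e M C S A Theta}.
Arguments sf_polar {R m r e M C S A Theta}.
Arguments sf_CK {R m r e M C S A Theta}.
Arguments sf_A_cont {R m r e M C S A Theta}.
Arguments sf_derA {R m r e M C S A Theta}.

Section SpaceForm.
Context {R : realType} {m : nat} {r e : R} {M : set 'rV[R]_m.+2}.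
Context {C S A : R -> R} {Theta : set R}.
Hypothesis r0 : 0 < r.
Hypothesis sf : space_form r e M C S A Theta.
Local Notation V := 'rV[R]_m.+2.
Local Notation g := (wform (signature e)).

Lemma sign_sqr : e * e = 1.
Proof. by case: (sf_sign sf) => ->; rewrite ?mulr1// mulrNN mulr1. Qed.

Let rn0 : r != 0. Proof. by rewrite gt_eqF. Qed.

Lemma form_cos (p q : V) : g p q = e * (r ^+ 2 * (e * g p q / r ^+ 2)).
Proof. by rewrite -{1}[g p q]mul1r -sign_sqr; field. Qed.

Lemma space_norm {q} : M q -> g q q = e * r ^+ 2.
Proof. by move=> Mq; have [] := (sf_sheet sf q q Mq).1 Mq. Qed.

Lemma tangent_ge0 {q v} : M q -> g q v = 0 -> 0 <= g v v.
Proof.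
move=> Mq qv; have [->|v0] := eqVneq v 0; first by rewrite wform0l.
exact/ltW/(sf_tangent sf q).
Qed.

Lemma tangent_eq0 {q v} : M q -> g q v = 0 -> g v v = 0 -> v = 0.
Proof.
move=> Mq qv vv; apply/eqP/negPn/negP => v0.
by have := sf_tangent sf q v Mq qv v0; rewrite vv ltxx.
Qed.

Lemma tangent_CauchySchwarz {q u v} : M q -> g q u = 0 -> g q v = 0 ->
  g u v ^+ 2 <= g u u * g v v.
Proof.
move=> Mq qu qv; have [->|v0] := eqVneq v 0.
  by rewrite !wform0r expr0n mulr0.
have vv := sf_tangent sf q v Mq qv v0.
have w0 : g q (u - (g u v / g v v) *: v) = 0 by rewrite !wformE qu qv mulr0 subr0.
have := tangent_ge0 Mq w0; rewrite !wformE (wformC _ v u).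
rewrite [leRHS](_ : _ = (g u u * g v v - g u v ^+ 2) / g v v); last first.
  by field; rewrite gt_eqF.
by rewrite pmulr_lge0 ?invr_gt0// subr_ge0.
Qed.

(** [c] is the cosine, or hyperbolic cosine, of the angle between [p] and [q]:
    the tangential component has square norm [r ^+ 2] times the square of the
    corresponding sine. *)
Lemma tangent_part {p q} (c := e * g p q / r ^+ 2) : M p -> M q ->
  g q (p - c *: q) = 0 /\ g (p - c *: q) (p - c *: q) = e * r ^+ 2 * (1 - c ^+ 2).
Proof.
move=> Mp Mq; rewrite !wformE (space_norm Mp) (space_norm Mq) (wformC _ q p).
have E : g p q = e * (r ^+ 2 * c) := form_cos p q.
by rewrite E; split; ring.
Qed.

(** As tangent vectors have nonnegative square norm, [tangent_part] puts the
    normalized product of two points in the range of [C]. *)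
Lemma angle_exists {p q} : M p -> M q ->
  exists2 t, Theta t & g p q = e * (r ^+ 2 * C t).
Proof.
move=> Mp Mq; have [qw ww] := tangent_part Mp Mq.
have := tangent_ge0 Mq qw; rewrite {}ww; set c := e * g p q / _.
rewrite mulrAC pmulr_lge0 ?exprn_gt0// => c2.
have [|||t [Tt Ct _]] := sf_polar sf c (Num.sqrt (e * (1 - c ^+ 2))).
- by rewrite sqr_sqrtr// mulrA sign_sqr; ring.
- exact: sqrtr_ge0.
- have [_ []] := (sf_sheet sf p q Mq).1 Mp; last by right.
  by move=> ?; left; rewrite divr_gt0// exprn_gt0.
- by exists t => //; rewrite Ct; exact: form_cos.
Qed.

(** The condition on [k] reads [k < 1] on the sphere and [1 < k] in hyperbolic
    space: the scaled cosine moves away from the end points of the range of [C],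
    where [A] is not differentiable. *)
Lemma angle_scale {t k} : Theta t -> 0 < k -> 0 < e * (1 - k) ->
  exists t', [/\ Theta t', C t' = k * C t & 0 < S t'].
Proof.
move=> Tt k0 k1; have p := sf_pythagoras sf t.
have s0 : 0 < e * (1 - (k * C t) ^+ 2).
  case: (sf_sign sf) p k1 => -> p k1.
    have := sqr_ge0 (S t); nra.
  have := sqr_ge0 (S t); nra.
have [|||t' [Tt' Ct' St']] :=
    sf_polar sf (k * C t) (Num.sqrt (e * (1 - (k * C t) ^+ 2))).
- by rewrite sqr_sqrtr ?ltW// mulrA sign_sqr; ring.
- exact: sqrtr_ge0.
- by case: (sf_C_gt0 sf t) => [h|]; [left; rewrite mulr_gt0|right].
- by exists t'; split=> //; rewrite St' sqrtr_gt0.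
Qed.

Definition form_angle (p q : V) : R := A (e * g p q / r ^+ 2).

Lemma form_angleP {p q t} : Theta t -> g p q = e * (r ^+ 2 * C t) ->
  form_angle p q = t.
Proof.
move=> Tt E.
rewrite /form_angle E mulrA sign_sqr mul1r mulrC mulKf ?expf_neq0//.
by apply: (sf_CK sf); rewrite inE.
Qed.

Section Speed.
Context {gamma : R -> V}.
Hypothesis dgamma : forall t : R, derivable gamma t 1.
Hypothesis Mgamma : forall t : R, 0 <= t <= 1 -> M (gamma t).

Let dergamma (t : R) : is_derive t 1 gamma (derive1 gamma t).
Proof. by rewrite derive1E; apply: derivableP; exact: dgamma. Qed.

Lemma velocity_tangent (t : R) : 0 <= t <= 1 -> g (gamma t) (derive1 gamma t) = 0.
Proof.
move=> t01.
have h := is_derive_wform (signature e) (dergamma t) (dergamma t).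
have /eqP : g (gamma t) (derive1 gamma t) + g (gamma t) (derive1 gamma t) = 0.
  rewrite -{1}(wformC _ (derive1 gamma t)).
  apply: (derive_cst_on nondegenerate_unit_itv t01 _ h) => s s01.
  by rewrite (space_norm (Mgamma s s01)).
by rewrite -mulr2n mulrn_eq0/= => /eqP.
Qed.

(** The gradient of the cosine of the angle to [x] is [e / r ^+ 2] times the
    tangential part of [x], whose square norm is given by [tangent_part]; the
    bound is Cauchy-Schwarz in the tangent space. *)
Lemma cosine_speed {x} (c := fun t : R => e * g x (gamma t) / r ^+ 2) (t : R) :
  M x -> 0 <= t <= 1 -> exists2 d, is_derive t 1 c d &
  d ^+ 2 <= e * (1 - c t ^+ 2) * g (derive1 gamma t) (derive1 gamma t) / r ^+ 2.
Proof.
move=> Mx t01; have Mg := Mgamma t t01.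
exists (e * g x (derive1 gamma t) / r ^+ 2).
  have h := is_derive_wform (signature e) (is_derive_cst x t 1) (dergamma t).
  have h' := is_deriveZ (e / r ^+ 2) h.
  rewrite (_ : c = (e / r ^+ 2) \*: (fun t => g (cst x t) (gamma t)));
    last by apply/funext => s; rewrite /c /= mulrAC.
  by apply: is_derive_eq h' _; rewrite wform0l add0r mulrAC.
have [qw ww] := tangent_part Mx Mg; rewrite -/(c t) in qw ww.
have vt := velocity_tangent t t01.
have := tangent_CauchySchwarz Mg qw vt; rewrite ww.
have -> : g (x - c t *: gamma t) (derive1 gamma t) = g x (derive1 gamma t).
  by rewrite !wformE vt mulr0 subr0.
move=> CS.
rewrite (_ : (_ / _) ^+ 2 = g x (derive1 gamma t) ^+ 2 / r ^+ 4); last first.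
  by rewrite !exprMn expr2 sign_sqr mul1r; field.
rewrite ler_pdivrMr ?exprn_gt0//; apply: le_trans CS _.
by rewrite le_eqVlt; apply/predU1P; left; field.
Qed.

(** The curve may pass through [x] or its antipode, where [A] is not
    differentiable at the cosine of the angle to [x]; this is why the estimate
    concerns cosines scaled by [k].  Scaling is harmless for the speed, since
    [k ^+ 2 * (e * (1 - c ^+ 2)) <= e * (1 - (k * c) ^+ 2)]. *)
Lemma scaled_increment {x k} : continuous (derive1 gamma) -> M x ->
  0 < k -> 0 < e * (1 - k) ->
  r * A (k * (e * g x (gamma 1) / r ^+ 2)) - r * A (k * (e * g x (gamma 0) / r ^+ 2))
  <= curve_length g gamma.
Proof.
move=> cg Mx k0 k1; pose c t := e * g x (gamma t) / r ^+ 2.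
pose f t := r * A (k * c t).
pose v t := Num.sqrt (g (derive1 gamma t) (derive1 gamma t)).
have fspeed (t : R) : 0 <= t <= 1 -> exists2 d, is_derive t 1 f d & d <= v t.
  move=> t01; have [d cd d2] := cosine_speed t Mx t01; rewrite -/(c t) in d2.
  have Mg := Mgamma t t01.
  have [a Ta Ea] := angle_exists Mx Mg.
  have ca : C a = c t by rewrite /c Ea mulrA sign_sqr; field.
  have [b [Tb Cb Sb]] := angle_scale Ta k0 k1.
  have dA := sf_derA sf b Tb Sb; rewrite Cb ca in dA.
  have dkc := is_deriveZ k cd.
  have dAc := is_derive1_comp (f := A) (g := k \*: c) dA dkc.
  exists (r * (- e / S b * (k * d))); first exact: (is_deriveZ r dAc).
  apply: le_trans (ler_norm _) _; rewrite -sqrtr_sqr ler_wsqrtr//.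
  have pb := sf_pythagoras sf b.
  have vv := tangent_ge0 Mg (velocity_tangent t t01).
  set w := g (derive1 gamma t) _ in d2 vv *.
  have eS : e * S b ^+ 2 = 1 - (k * c t) ^+ 2 by rewrite -ca -Cb -pb; ring.
  have eSb : S b ^+ 2 = e * (1 - (k * c t) ^+ 2).
    by rewrite -eS mulrA sign_sqr mul1r.
  rewrite (_ : _ ^+ 2 = (r * k * d) ^+ 2 / S b ^+ 2); last first.
    rewrite !exprMn exprVn sqrrN (expr2 e) sign_sqr; ring.
  rewrite ler_pdivrMr ?exprn_gt0// eSb 2!exprMn.
  apply: (@le_trans _ _ (k ^+ 2 * (e * (1 - c t ^+ 2) * w))).
    rewrite (_ : k ^+ 2 * _ = r ^+ 2 * k ^+ 2 * (e * (1 - c t ^+ 2) * w / r ^+ 2)).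
      by rewrite ler_wpM2l// mulr_ge0// sqr_ge0.
    by field.
  rewrite (_ : k ^+ 2 * _ = w * (k ^+ 2 * (e * (1 - c t ^+ 2)))); last by ring.
  rewrite ler_wpM2l// -subr_ge0.
  rewrite (_ : _ - _ = e * (1 - k) * (1 + k)); last by ring.
  by rewrite mulr_ge0// ltW// addr_gt0.
have cv : continuous v.
  move=> t; apply: (@continuous_comp _ _ _
    (fun t : R => g (derive1 gamma t) (derive1 gamma t)) (@Num.sqrt R)).
    exact: continuous_wform.
  exact: sqrt_continuous.
apply: (increment_le_Rintegral f ('D_1 f) v) => //.
  by move=> t /fspeed[d [df _] _]; exact: derivableP.
by move=> t /fspeed[d [_ ->] dv].
Qed.

End Speed.

(** * Riemannian distance *)

(** Scaling factors that tend to [1] from the side required by [angle_scale]. *)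
Let scale (n : nat) : R := 1 - e / 2 * harmonic n.

Let scale_gt0 n : 0 < scale n.
Proof.
have h0 : 0 < harmonic n :> R by exact: harmonic_gt0.
have h1 : harmonic n <= 1 :> R by rewrite /harmonic/= invf_le1 ?ler1n.
by rewrite /scale; case: (sf_sign sf) => ->; lra.
Qed.

Let scale_inside n : 0 < e * (1 - scale n).
Proof.
have h0 : 0 < harmonic n :> R by exact: harmonic_gt0.
rewrite (_ : e * _ = e * e / 2 * harmonic n); last by rewrite /scale; ring.
by rewrite sign_sqr mul1r mulr_gt0// invr_gt0.
Qed.

Let scale_cvg t : Theta t -> A (scale n * C t) @[n --> \oo] --> A (C t).
Proof.
move=> Tt; have cA := (subspace_continuousP _ A).1 (sf_A_cont sf) (C t).
have {}cA := cA (ex_intro2 _ _ t Tt erefl).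
have sc : scale n * C t @[n --> \oo] --> C t.
  rewrite -[X in _ --> X]mul1r; apply: cvgMl.
  rewrite /scale -[X in _ --> X]subr0; apply: cvgB; first exact: cvg_cst.
  by rewrite -[X in _ --> X](mulr0 (e / 2)); apply: cvgMr; exact: cvg_harmonic.
apply: cvg_trans cA => P [/= d d0 Pd]; have : \forall n \near \oo, ball (C t) d (scale n * C t).
  by apply: sc; exact: nbhsx_ballx.
apply: filterS => n nd; apply: Pd => //.
have [t' [Tt' <- _]] := angle_scale Tt (scale_gt0 n) (scale_inside n).
by exists t'.
Qed.

Lemma form_angle_increment {x} {gamma : R -> V} : M x ->
  (forall t : R, derivable gamma t 1) -> continuous (derive1 gamma) ->
  (forall t : R, 0 <= t <= 1 -> M (gamma t)) ->
  r * form_angle x (gamma 1) - r * form_angle x (gamma 0) <= curve_length g gamma.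
Proof.
move=> Mx dg cg Mg.
have cvgA (t : R) : 0 <= t <= 1 ->
    r * A (scale n * (e * g x (gamma t) / r ^+ 2)) @[n --> \oo] --> r * form_angle x (gamma t).
  move=> t01; have [a Ta Ea] := angle_exists Mx (Mg t t01).
  apply: cvgMr; rewrite /form_angle (_ : e * _ / _ = C a); first exact: scale_cvg.
  by rewrite Ea mulrA sign_sqr; field.
have c1 := cvgA 1; have c0 := cvgA 0; rewrite !lexx !ler01 in c0 c1.
have c10 := cvgB (c1 isT) (c0 isT) _.
have cL : (fun=> curve_length g gamma) n @[n --> \oo] --> curve_length g gamma.
  exact: cvg_cst.
apply: (ler_cvg_to (c10 _) cL).
by apply: nearW => n; exact: scaled_increment.
Qed.

(** Comparing angles to a fixed base point makes the estimate telescope over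
    concatenated pieces. *)
Lemma form_angle_le_length {x p q l} : M x -> piecewise_C1_length g M p q l ->
  r * form_angle x q - r * form_angle x p <= l.
Proof.
move=> Mx; elim=> {p q l} [gamma dg cg Mg|p q w l l' _ IH _ IH'].
  exact: (form_angle_increment Mx dg cg Mg).
lra.
Qed.

(** [u] is the initial direction of a unit speed geodesic from [p] to [q]. *)
Lemma polar_coordinates {p q} : M p -> M q -> exists t u,
  [/\ Theta t, g p u = 0, g u u = 1 & q = C t *: p + (r * S t) *: u].
Proof.
move=> Mp Mq; have [t Tt Et] := angle_exists Mq Mp.
have py := sf_pythagoras sf t.
have [pw ww] := tangent_part Mq Mp.
move: pw ww; rewrite (_ : e * g q p / r ^+ 2 = C t); last first.
  by rewrite Et mulrA sign_sqr; field.
move=> pw; rewrite (_ : e * _ * _ = r ^+ 2 * S t ^+ 2); last first.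
  by rewrite -py addrC addKr mulrACA sign_sqr mul1r.
move=> ww; have [St|St] := eqVneq (S t) 0.
  (* [q] is [p] or its antipode: every direction leads to it. *)
  have [u [pu uu]] := sf_unit sf p Mp; exists t, u; split=> //.
  apply/eqP; rewrite St mulr0 scale0r addr0 -subr_eq0.
  by apply/eqP/(tangent_eq0 Mp pw); rewrite ww St expr0n mulr0.
exists t, ((r * S t)^-1 *: (q - C t *: p)); split=> //.
- by rewrite wformZr pw mulr0.
- by rewrite wformZl wformZr ww; field; rewrite St rn0.
- by rewrite scalerA divff ?mulf_neq0// scale1r addrC subrK.
Qed.

Lemma geodesic_length {p q} : M p -> M q ->
  piecewise_C1_length g M p q (r * form_angle p q).
Proof.
move=> Mp Mq; have [t [u [Tt pu uu E]]] := polar_coordinates Mp Mq.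
have up : g u p = 0 by rewrite wformC.
have S0 : S 0 = 0.
  have := sf_pythagoras sf 0; rewrite (sf_C0 sf) expr1n => /eqP.
  rewrite -subr_eq0 addrC addKr mulf_eq0 expf_eq0/=.
  by case/orP => [/eqP e0|/eqP//]; have := sign_sqr; rewrite e0 mulr0 => /eqP; rewrite eq_sym oner_eq0.
pose gamma (s : R) : V := C (t * s) *: p + (r * S (t * s)) *: u.
pose dgamma (s : R) : V := (t * (- e * S (t * s))) *: p + (r * (t * C (t * s))) *: u.
have py s := sf_pythagoras sf s.
have dC (s : R) : is_derive s 1 (fun s => C (t * s)) (t * (- e * S (t * s))).
  rewrite mulrC; apply: (@is_derive1_comp _ C ( *%R t)); first exact: sf_derC sf _.
  by apply: is_derive_eq (is_deriveZ t (is_derive_id s 1)) _; rewrite /GRing.scale/= mulr1.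
have dS (s : R) : is_derive s 1 (fun s => S (t * s)) (t * C (t * s)).
  rewrite mulrC; apply: (@is_derive1_comp _ S ( *%R t)); first exact: sf_derS sf _.
  by apply: is_derive_eq (is_deriveZ t (is_derive_id s 1)) _; rewrite /GRing.scale/= mulr1.
have dg (s : R) : is_derive s 1 gamma (dgamma s).
  exact: (is_deriveD (is_derive_scale p (dC s)) (is_derive_scale u (is_deriveZ r (dS s)))).
have ddg (s : R) : derivable dgamma s 1.
  have dS' := is_derive_scale p (is_deriveZ t (is_deriveZ (- e) (dS s))).
  have dC' := is_derive_scale u (is_deriveZ r (is_deriveZ t (dC s))).
  by have [] := is_deriveD dS' dC'.
have dgE : derive1 gamma = dgamma.
  by apply/funext => s; rewrite derive1E; have [] := dg s.
have gg s : g (gamma s) (gamma s) = e * r ^+ 2.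
  rewrite !wformE pu up uu (space_norm Mp) -[RHS]mulr1 -[in RHS](py (t * s)).
  ring: sign_sqr.
have pg s : g (gamma s) p = e * (r ^+ 2 * C (t * s)).
  by rewrite !wformE up (space_norm Mp); ring.
have Mg s : M (gamma s).
  apply/(sf_sheet sf _ _ Mp); split; first exact: gg.
  rewrite pg mulrA sign_sqr mul1r.
  by case: (sf_C_gt0 sf (t * s)) => h; [left; rewrite mulr_gt0 ?exprn_gt0|right].
have vg s : g (derive1 gamma s) (derive1 gamma s) = (r * t) ^+ 2.
  rewrite dgE !wformE pu up uu (space_norm Mp) -[RHS]mulr1 -[in RHS](py (t * s)).
  ring: sign_sqr.
have -> : r * form_angle p q = curve_length g gamma.
  rewrite (form_angleP Tt)//.
    rewrite /curve_length; under eq_Rintegral do rewrite vg sqrtr_sqr.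
    rewrite Rintegral_cst//= lebesgue_measure_itv/= lte_fin ltr01 sube0/= mulr1.
    by rewrite ger0_norm // mulr_ge0 //; [exact: ltW|exact: (sf_Theta_ge0 sf)].
  by rewrite E !wformE pu (space_norm Mp); ring.
have {1}-> : p = gamma 0 by rewrite /gamma mulr0 (sf_C0 sf) S0 mulr0 scale0r addr0 scale1r.
have -> : q = gamma 1 by rewrite /gamma mulr1.
have dvg (s : R) : derivable gamma s 1 by have [] := dg s.
have cdg : continuous (derive1 gamma).
  by rewrite dgE => s; apply: differentiable_continuous; exact/derivable1_diffP.
exact: (@C1_piece R m g M gamma dvg cdg (fun s _ => Mg s)).
Qed.

(** The infimum is attained by the geodesic; the lower bound is the angle
    estimate with base point [p]. *)
Theorem riem_distE {p q} : M p -> M q -> riem_dist g M p q = (r * form_angle p q)%:E.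
Proof.
move=> Mp Mq; apply/eqP; rewrite eq_le; apply/andP; split.
  by apply: ereal_inf_lbound; exists (r * form_angle p q) => //; exact: geodesic_length.
apply: le_ereal_inf_tmp => _ [l /= pql <-]; rewrite lee_fin.
have := form_angle_le_length Mp pql.
by rewrite [X in _ - r * X](form_angleP (sf_Theta0 sf)) ?mulr0 ?subr0// (sf_C0 sf) mulr1 space_norm.
Qed.

(** * Curves on geodesic spheres *)

Let en0 : e != 0.
Proof. by case: (sf_sign sf) => ->; rewrite ?oppr_eq0 oner_eq0. Qed.

Lemma riem_dist_eqP {p q} z0 : M p -> M q ->
  riem_dist g M p q = z0%:E <-> Theta (z0 / r) /\ g p q = e * (r ^+ 2 * C (z0 / r)).
Proof.
move=> Mp Mq; have [t Tt Et] := angle_exists Mp Mq.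
rewrite (riem_distE Mp Mq) (form_angleP Tt Et); split=> [[<-]|[Tz Ez]].
  by rewrite mulrC mulKf.
congr EFin; rewrite -(form_angleP Tt Et) (form_angleP Tz Ez).
by rewrite mulrC divfK.
Qed.

Section Curve.
Context {I : set R} {alpha : R -> V} {n : 'I_m -> R -> V} {kappa : 'I_m -> R -> R}.
Hypothesis I_itv : nondegenerate_interval I.
Hypothesis curve : arc_length_curve g M I alpha.
Hypothesis frame : RM_frame g I alpha n.
Hypothesis curvatures : RM_curvatures g I alpha n kappa.
Local Notation t := (derive1 alpha).

Let d_alpha {s} : I s -> is_derive s 1 alpha (t s).
Proof.
case: curve => -[d2 _] _ _ Is; rewrite derive1E; apply: derivableP.
by case: (d2 s Is).
Qed.

Let d_t {s} : I s -> is_derive s 1 t (derive1 t s).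
Proof.
case: curve => -[d2 _] _ _ Is; rewrite [derive1 t s]derive1E; apply: derivableP.
by case: (d2 s Is).
Qed.

Let d_n {i s} : I s -> is_derive s 1 (n i) (derive1 (n i) s).
Proof.
case: frame => _ d2 Is; rewrite [derive1 (n i) s]derive1E; apply: derivableP.
by case: (d2 i s Is).
Qed.

Let M_alpha {s} : I s -> M (alpha s). Proof. by case: curve => _ h _; exact: h. Qed.

Let aa {s} : I s -> g (alpha s) (alpha s) = e * r ^+ 2.
Proof. by move/M_alpha/space_norm. Qed.

Let tt1 {s} : I s -> g (t s) (t s) = 1.
Proof. by case: curve => _ _; apply. Qed.

Let at0 {s} : I s -> g (alpha s) (t s) = 0.
Proof.
move=> Is; have h := is_derive_wform (signature e) (d_alpha Is) (d_alpha Is).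
have /eqP : g (alpha s) (t s) + g (alpha s) (t s) = 0.
  by rewrite -{1}(wformC _ (t s)); exact: (derive_cst_on I_itv Is (@aa) h).
by rewrite -mulr2n mulrn_eq0/= => /eqP.
Qed.

Let an0 {i s} : I s -> g (alpha s) (n i s) = 0.
Proof. by case: frame => o _ /o[tn _ _]; rewrite wformC; exact: tn. Qed.

Let tn0 {i s} : I s -> g (t s) (n i s) = 0.
Proof. by case: frame => o _ /o[_ tn _]; rewrite wformC; exact: tn. Qed.

Let nn {i j s} : I s -> g (n i s) (n j s) = (i == j)%:R.
Proof. by case: frame => o _ /o[_ _]; apply. Qed.

(** The normal part of the acceleration in the ambient space is known because
    [g alpha'' alpha = - g alpha' alpha' = -1]. *)
Lemma acceleration {s} : I s ->
  is_derive s 1 t (\sum_i kappa i s *: n i s - (e / r ^+ 2) *: alpha s).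
Proof.
move=> Is; apply: is_derive_eq (d_t Is) _.
have [<- _] := curvatures s Is; rewrite /cov_deriv (aa Is).
have h := is_derive_wform (signature e) (d_alpha Is) (d_t Is).
have /eqP := derive_cst_on I_itv Is (@at0) h.
rewrite (tt1 Is) addrC addr_eq0 wformC => /eqP ->.
rewrite (_ : -1 / _ = - (e / r ^+ 2)); first by rewrite scaleNr opprK addrK.
by case: (sf_sign sf) => ->; field.
Qed.

(** The derivative of [n i] in the ambient space has no component along
    [alpha], because [n i] is orthogonal to both [alpha] and [alpha']. *)
Lemma normal_derivative {i s} : I s -> is_derive s 1 (n i) (- kappa i s *: t s).
Proof.
move=> Is; apply: is_derive_eq (d_n Is) _.
have [_ /(_ i) <-] := curvatures s Is; rewrite /cov_deriv (aa Is).
have h := is_derive_wform (signature e) (d_alpha Is) (d_n (i := i) Is).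
have := derive_cst_on I_itv Is (@an0 i) h.
by rewrite (tn0 Is) add0r wformC => ->; rewrite mul0r scale0r subr0.
Qed.

(** The position vector, the tangent and the normals are [m + 2] orthogonal
    vectors, none of them isotropic, in a space of dimension [m + 2]. *)
Lemma frame_expansion {s} (x : V) : I s ->
  x = (e * g x (alpha s) / r ^+ 2) *: alpha s + g x (t s) *: t s
      + \sum_i g x (n i s) *: n i s.
Proof.
move=> Is.
pose b (j : 'I_m.+2) : V := if unlift ord0 j is Some j' then
  if unlift ord0 j' is Some i then n i s else t s else alpha s.
have b0 : b ord0 = alpha s by rewrite /b unlift_none.
have b1 : b (lift ord0 ord0) = t s by rewrite /b liftK unlift_none.
have b2 i : b (lift ord0 (lift ord0 i)) = n i s by rewrite /b !liftK.
have bE (j : 'I_m.+2) : j = ord0 \/ j = lift ord0 ord0 \/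
      exists i : 'I_m, j = lift ord0 (lift ord0 i).
  case: (unliftP ord0 j) => [j' ->|->]; last by left.
  case: (unliftP ord0 j') => [i ->|->]; last by right; left.
  by right; right; exists i.
have an' i := an0 (i := i) Is; have tn' i := tn0 (i := i) Is.
have norms (j : 'I_m.+2) : g (b j) (b j) != 0.
  have [->|[->|[i ->]]] := bE j.
  - by rewrite b0 (aa Is) mulf_neq0 ?expf_neq0.
  - by rewrite b1 (tt1 Is) oner_eq0.
  - by rewrite b2 (nn Is) eqxx oner_eq0.
have orth (j l : 'I_m.+2) : j != l -> g (b j) (b l) = 0.
  have [->|[->|[i ->]]] := bE j; have [->|[->|[i' ->]]] := bE l;
    rewrite ?eqxx// ?b0 ?b1 ?b2 => jl; rewrite ?at0// ?an'// ?tn'//.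
  - by rewrite wformC at0.
  - by rewrite wformC an'.
  - by rewrite wformC tn'.
  - by rewrite (nn Is); have [ii|//] := eqVneq i i'; rewrite ii eqxx in jl.
rewrite [LHS](orthogonal_expansion _ b norms orth).
rewrite !big_ord_recl b0 b1 (aa Is) (tt1 Is) divr1 addrA; congr (_ + _ + _).
  by congr (_ *: _); case: (sf_sign sf) => ->; field.
by apply: eq_bigr => i _; rewrite b2 (nn Is) eqxx divr1.
Qed.

Lemma frame_Parseval {s} (x : V) : I s ->
  g x x = e * g x (alpha s) ^+ 2 / r ^+ 2 + g x (t s) ^+ 2 + \sum_i g x (n i s) ^+ 2.
Proof.
move=> Is; rewrite [in X in g _ X](frame_expansion x Is) !wformDr !wformZr wform_sumr.
congr (_ + _ + _); first by ring.
by apply: eq_bigr => i _; rewrite wformZr.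
Qed.

Let I_nonempty : exists s, I s.
Proof. by case: I_itv => _ [x [_ [Ix _ _]]]; exists x. Qed.

Let curve_not_cst p : ~ forall s, I s -> alpha s = p.
Proof.
move=> ap; have [s Is] := I_nonempty.
suff t0 : t s = 0 by have := tt1 Is; rewrite t0 wform0l => /esym/eqP; rewrite oner_eq0.
apply/rowP => i; rewrite mxE.
have ap0 u : I u -> alpha u 0 i = p 0 i by move=> /ap ->.
exact: (derive_cst_on I_itv Is ap0 (is_derive_coord i (d_alpha Is))).
Qed.

(** The components [g p (n i s)] of the centre along the normals are constant,
    because [p] stays orthogonal to the tangent; differentiating that
    orthogonality gives the linear relation. *)
Lemma center_relation {p c sigma} : g p p = e * r ^+ 2 ->
  c ^+ 2 + e * sigma ^+ 2 = 1 ->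
  (forall s, I s -> g p (alpha s) = e * (r ^+ 2 * c)) ->
  sigma != 0 /\ exists a : 'I_m -> R, \sum_(i < m) a i ^+ 2 = 1 /\
    forall s, I s -> \sum_(i < m) a i * kappa i s + r^-1 * (c / sigma) = 0.
Proof.
move=> pp cs pa.
have pt s : I s -> g p (t s) = 0.
  move=> Is; have h := is_derive_wform (signature e) (is_derive_cst p s 1) (d_alpha Is).
  by have := derive_cst_on I_itv Is pa h; rewrite wform0l add0r.
have [s0 Is0] := I_nonempty; pose b i := g p (n i s0).
have pn i s : I s -> g p (n i s) = b i.
  move=> Is; have dpn u : I u -> is_derive u 1 (fun s => g p (n i s)) 0.
    move=> Iu; have dn := normal_derivative (i := i) Iu.
    have h := is_derive_wform (signature e) (is_derive_cst p u 1) dn.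
    by apply: is_derive_eq h _; rewrite wform0l add0r wformZr [g _ _]pt// mulr0.
  exact: (derive0_cst_on I_itv.1 dpn s s0 Is Is0).
have b2 : \sum_i b i ^+ 2 = r ^+ 2 * sigma ^+ 2.
  have := frame_Parseval p Is0; rewrite pp (pa s0 Is0) (pt s0 Is0) expr0n addr0.
  move=> E; have {E} -> : \sum_i b i ^+ 2
      = e * r ^+ 2 - e * (e * (r ^+ 2 * c)) ^+ 2 / r ^+ 2 by rewrite E addrC addKr.
  have c2 : c ^+ 2 = 1 - e * sigma ^+ 2 by rewrite -cs addrK.
  rewrite (_ : _ - _ = e * r ^+ 2 - e * (e * e) * r ^+ 2 * c ^+ 2); last by field.
  by rewrite c2; ring: sign_sqr.
have kb s : I s -> \sum_i b i * kappa i s = c.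
  move=> Is.
  have h := is_derive_wform (signature e) (is_derive_cst p s 1) (acceleration Is).
  have {h} := derive_cst_on I_itv Is pt h.
  rewrite wform0l add0r wformBr wform_sumr wformZr [g p (alpha s)]pa// => /eqP.
  rewrite subr_eq0 => /eqP E.
  rewrite (_ : c = e / r ^+ 2 * (e * (r ^+ 2 * c))); last first.
    by case: (sf_sign sf) => ->; field.
  by rewrite -E; apply: eq_bigr => i _; rewrite wformZr [g _ _]pn// mulrC.
(* If [sigma] vanished, all [b i] would, so [p] would be proportional to
   [alpha s] and the curve would be constant. *)
have s0n : sigma != 0.
  apply/negP => /eqP sigma0.
  have c2 : c ^+ 2 = 1 by rewrite -cs sigma0 expr0n mulr0 addr0.
  have bi i : b i = 0.
    apply/eqP; rewrite -sqrf_eq0; apply/eqP.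
    have := b2; rewrite sigma0 expr0n mulr0 => /eqP; rewrite psumr_eq0; last first.
      by move=> j _; exact: sqr_ge0.
    by move=> /allP/(_ i); rewrite mem_index_enum => /(_ isT)/eqP.
  apply: (curve_not_cst (c *: p)) => s Is.
  rewrite [in RHS](frame_expansion p Is).
  rewrite pt// scale0r addr0 big1 => [|i _]; last by rewrite pn// bi scale0r.
  rewrite addr0 scalerA pa// (_ : _ * _ = e * e * c ^+ 2); last by field.
  by rewrite c2 sign_sqr mulr1 scale1r.
split=> //; exists (fun i => - b i / (r * sigma)); split.
  rewrite (eq_bigr (fun i => (r * sigma) ^- 2 * b i ^+ 2)); last first.
    by move=> i _; field; rewrite rn0 s0n.
  by rewrite -mulr_sumr b2; field; rewrite rn0 s0n.
move=> s Is; rewrite (eq_bigr (fun i => - (r * sigma)^-1 * (b i * kappa i s))); last first.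
  by move=> i _; field; rewrite rn0 s0n.
by rewrite -mulr_sumr kb//; field; rewrite rn0 s0n.
Qed.

(** The centre is found by inverting the expansion of [center_relation]: the
    relation makes the derivative of the candidate [p s], a multiple of the
    tangent, vanish. *)
Lemma relation_center {a : 'I_m -> R} {c sigma} : sigma != 0 ->
  c ^+ 2 + e * sigma ^+ 2 = 1 -> \sum_(i < m) a i ^+ 2 = 1 ->
  (forall s, I s -> \sum_(i < m) a i * kappa i s + r^-1 * (c / sigma) = 0) ->
  exists2 p, g p p = e * r ^+ 2 & forall s, I s -> g p (alpha s) = e * (r ^+ 2 * c).
Proof.
move=> sn0 cs a1 ak.
pose p (s : R) : V := c *: alpha s + (- (r * sigma)) *: \sum_i a i *: n i s.
have dp s : I s -> is_derive s 1 p 0.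
  move=> Is.
  have h := @is_derive_sum R R V _ (fun i s => a i *: n i s) s 1 _
    (fun i => is_deriveZ (a i) (normal_derivative (i := i) Is)).
  have h' := is_deriveD (is_deriveZ c (d_alpha Is)) (is_deriveZ (- (r * sigma)) h).
  rewrite (_ : p = c \*: alpha + - (r * sigma) \*: \sum_i (fun s => a i *: n i s)); last first.
    by apply/funext => u; rewrite /p /= fctE fct_sumE.
  apply: is_derive_eq h' _.
  under eq_bigr do rewrite scalerA.
  rewrite -scaler_suml scalerA -scalerDl; apply/eqP; rewrite scaler_eq0; apply/orP; left.
  have -> : \sum_i a i * - kappa i s = - \sum_i a i * kappa i s.
    by rewrite -sumrN; apply: eq_bigr => i _; rewrite mulrN.
  move/eqP: (ak s Is); rewrite addr_eq0 => /eqP ->; apply/eqP; field.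
  by rewrite rn0 sn0.
have [s0 Is0] := I_nonempty; exists (p s0); last first.
  move=> s Is; have -> : p s0 = p s.
    apply/rowP => i; apply: (derive0_cst_on (f := fun s => p s 0 i) I_itv.1) => // u Iu.
    by have := is_derive_coord i (dp u Iu); rewrite mxE.
  rewrite /p !wformE (aa Is) wform_suml big1; first by ring.
  by move=> i _; rewrite wformZl wformC an0// mulr0.
have an' : g (alpha s0) (\sum_i a i *: n i s0) = 0.
  by rewrite wform_sumr big1// => i _; rewrite wformZr an0// mulr0.
have nn' : g (\sum_i a i *: n i s0) (\sum_i a i *: n i s0) = 1.
  rewrite wform_suml -a1; apply: eq_bigr => i _; rewrite wformZl wform_sumr.
  rewrite (bigD1 i)//= wformZr nn// eqxx mulr1 big1 ?addr0// => j ji.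
  by rewrite wformZr nn// eq_sym (negPf ji) mulr0.
rewrite /p !wformE (aa Is0) (wformC _ _ (alpha s0)) an' nn' -[in RHS](mulr1 (_ * _)) -[in RHS]cs.
ring: sign_sqr.
Qed.

Theorem lies_on_geodesic_sphereP z0 : lies_on_geodesic_sphere g M I alpha z0 <->
  [/\ Theta (z0 / r), S (z0 / r) != 0 & exists a : 'I_m -> R,
    \sum_(i < m) a i ^+ 2 = 1 /\ forall s, I s ->
      \sum_(i < m) a i * kappa i s + r^-1 * (C (z0 / r) / S (z0 / r)) = 0].
Proof.
have [s0 Is0] := I_nonempty; have py := sf_pythagoras sf (z0 / r).
split=> [[p Mp pz]|[Tz Sn0 [a [a1 ak]]]].
  have pz' s : I s -> Theta (z0 / r) /\ g p (alpha s) = e * (r ^+ 2 * C (z0 / r)).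
    move=> Is; have [Mz dz] := pz s Is.
    exact/(riem_dist_eqP z0 Mp (M_alpha Is)).
  have [Tz _] := pz' s0 Is0.
  by have [] := center_relation (space_norm Mp) py (fun s Is => (pz' s Is).2).
have [p pp pa] := relation_center Sn0 py a1 ak.
have Mp : M p.
  apply/(sf_sheet sf _ _ (M_alpha Is0)); split=> //.
  rewrite pa// mulrA sign_sqr mul1r.
  by case: (sf_C_gt0 sf (z0 / r)) => h; [left; rewrite mulr_gt0 ?exprn_gt0|right].
exists p => // s Is; split; first exact: M_alpha.
by apply/(riem_dist_eqP z0 Mp (M_alpha Is)); split=> //; exact: pa.
Qed.

(** Dividing the relation by the norm of [a] normalizes [a] and replaces the
    cotangent [x] of the angle by [x] over that norm; the radius [z] is the one
    with this new cotangent.  It exists under the hypothesis on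
    [x ^+ 2 + e * a2], which for [e = -1] says that the new cotangent exceeds
    [1]. *)
Lemma relation_on_geodesic_sphere {a : 'I_m -> R} {x : R} :
  let a2 := \sum_(i < m) a i ^+ 2 in
  0 < a2 -> 0 < x ^+ 2 + e * a2 -> 0 < x \/ e = 1 ->
  (forall s, I s -> \sum_(i < m) a i * kappa i s + r^-1 * x = 0) ->
  exists z, [/\ lies_on_geodesic_sphere g M I alpha z, Theta (z / r)
    & 0 < x -> 0 < C (z / r)].
Proof.
move=> a2 a20 xa xe ak.
pose k := Num.sqrt a2; have k0 : 0 < k by rewrite sqrtr_gt0.
have k2 : k ^+ 2 = a2 by rewrite sqr_sqrtr// ltW.
pose d := Num.sqrt (x ^+ 2 + e * a2); have d0 : 0 < d by rewrite sqrtr_gt0.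
have d2 : d ^+ 2 = x ^+ 2 + e * a2 by rewrite sqr_sqrtr// ltW.
have kn0 : k != 0 by rewrite gt_eqF.
have dn0 : d != 0 by rewrite gt_eqF.
(* [(x, k)] is normalized to a point of the conic; its cotangent is [x / k]. *)
have [|||t [Tt Ct St]] := sf_polar sf (x / d) (k / d).
- rewrite !exprMn exprVn k2 mulrA -mulrDl d2 divff// -d2.
  by rewrite expf_neq0.
- by rewrite divr_ge0// ltW.
- by case: xe => [x0|]; [left; rewrite divr_gt0|right].
exists (r * t).
have E : r * t / r = t by rewrite mulrC mulKf.
rewrite E Ct; split=> //; last by move=> x0; rewrite divr_gt0.
apply/lies_on_geodesic_sphereP.
rewrite E Ct St; split=> //; first by rewrite mulf_neq0// invr_eq0.
exists (fun i => a i / k); split.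
  under eq_bigr do rewrite exprMn.
  by rewrite -mulr_suml exprVn k2 divff// gt_eqF.
move=> s Is; rewrite (eq_bigr (fun i => k^-1 * (a i * kappa i s))); last first.
  by move=> i _; rewrite mulrAC mulrC.
rewrite -mulr_sumr (_ : x / d / (k / d) = k^-1 * x); last by field; rewrite kn0 dn0.
by rewrite mulrCA -mulrDr ak// mulr0.
Qed.

End Curve.

End SpaceForm.

(** * The two models *)

Section SignatureForm.
Context {R : realType} {m : nat}.
Local Notation V := 'rV[R]_m.+2.

Lemma wform_signature (e : R) (x y : V) :
  wform (signature e) x y = e * (x 0 ord0 * y 0 ord0)
    + \sum_(i < m.+1) x 0 (lift ord0 i) * y 0 (lift ord0 i).
Proof.
by rewrite /wform big_ord_recl; congr (_ + _); apply: eq_bigr => i _; rewrite mul1r.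
Qed.

Lemma wform_signature_sqr (e : R) (x : V) :
  wform (signature e) x x = e * x 0 ord0 ^+ 2 + \sum_(i < m.+1) x 0 (lift ord0 i) ^+ 2.
Proof. by rewrite wform_signature expr2; under eq_bigr do rewrite -expr2. Qed.

Lemma euclid_formE : @euclid_form R m = wform (signature 1).
Proof.
apply/funext => x; apply/funext => y; apply: eq_bigr => i _.
by rewrite /signature if_same mul1r.
Qed.

Lemma lorentz_formE : @lorentz_form R m = wform (signature (-1)).
Proof.
by apply/funext => x; apply/funext => y; rewrite wform_signature mulN1r.
Qed.

Lemma wform_delta (e : R) (q : V) i :
  wform (signature e) q (delta_mx 0 i) = signature e i * q 0 i.
Proof.
rewrite /wform (bigD1 i)//= big1 => [|j ji]; last by rewrite mxE (negPf ji) !mulr0.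
by rewrite mxE !eqxx mulr1 addr0.
Qed.

(** The direction is the tangential part of the [i]-th coordinate axis, and the
    positivity hypothesis says that its square norm is positive. *)
Lemma unit_tangent_of_axis {r e : R} {q : V} {i} : e * e = 1 -> r != 0 ->
  signature e i = 1 -> wform (signature e) q q = e * r ^+ 2 ->
  0 < r ^+ 2 - e * q 0 i ^+ 2 ->
  exists u, wform (signature e) q u = 0 /\ wform (signature e) u u = 1.
Proof.
move=> ee rn0 wi qq; set k := _ - _ => k0.
pose w : V := delta_mx 0 i - (e * q 0 i / r ^+ 2) *: q.
have qw : wform (signature e) q w = 0.
  rewrite !wformE wform_delta wi qq.
  rewrite (_ : _ - _ = (1 - e * e) * q 0 i); last by field.
  by rewrite ee subrr mul0r.
have ww : wform (signature e) w w = k / r ^+ 2.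
  rewrite {1}/w wformBl wformZl qw mulr0 subr0 /w wformBr wformZr wform_delta wi.
  rewrite wformC wform_delta wi mxE !eqxx mul1r mulr1n /k; field.
  by [].
have s0 : 0 < k / r ^+ 2 by rewrite divr_gt0// exprn_even_gt0.
exists ((Num.sqrt (k / r ^+ 2))^-1 *: w); split; first by rewrite wformZr qw mulr0.
rewrite wformZl wformZr ww mulrA -invfM -expr2 sqr_sqrtr ?ltW//.
by rewrite mulVf// gt_eqF.
Qed.

End SignatureForm.

Lemma sum_CauchySchwarz {R : realType} {k : nat} (x y : 'I_k -> R) :
  (\sum_i x i * y i) ^+ 2 <= (\sum_i x i ^+ 2) * (\sum_i y i ^+ 2).
Proof.
set X := \sum_i x i ^+ 2; set Y := \sum_i y i ^+ 2; set P := \sum_i x i * y i.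
have Y0 : 0 <= Y by apply: sumr_ge0 => i _; exact: sqr_ge0.
have H l : 0 <= X - 2 * l * P + l ^+ 2 * Y.
  rewrite (_ : _ + _ = \sum_i (x i - l * y i) ^+ 2).
    by apply: sumr_ge0 => i _; exact: sqr_ge0.
  rewrite /X /P /Y !mulr_sumr -sumrB -big_split; apply: eq_bigr => i _ /=; ring.
have [y0|yn0] := eqVneq Y 0.
  suff -> : P = 0 by rewrite y0 expr0n mulr0.
  rewrite /P big1// => i _; move/eqP: y0; rewrite psumr_eq0 => [|j _]; last exact: sqr_ge0.
  by move=> /allP/(_ i); rewrite mem_index_enum sqrf_eq0 => /(_ isT)/eqP ->; rewrite mulr0.
have := H (P / Y); rewrite (_ : _ + _ = (X * Y - P ^+ 2) / Y); last by field.
by rewrite pmulr_lge0 ?invr_gt0 ?lt0r ?yn0// subr_ge0.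
Qed.

Section Sphere.
Context {R : realType} {m : nat} {r : R}.
Hypothesis r0 : 0 < r.

Lemma sphere_space_form :
  @space_form R m r 1 (sphere_space r) cos sin acos [set t | 0 <= t <= pi].
Proof.
split.
- by left.
- move=> p q _; rewrite /sphere_space/= euclid_formE mul1r.
  by split=> [->|[]//]; split=> //; right.
- move=> _ v _ _ v0; rewrite lt0r; apply/andP; split; last first.
    by apply: sumr_ge0 => i _; rewrite /signature if_same mul1r sqr_ge0.
  apply: contraNneq v0 => /eqP; rewrite psumr_eq0 => [/allP vv|i _]; last first.
    by rewrite /signature if_same mul1r sqr_ge0.
  apply/eqP/rowP => i; rewrite mxE; have := vv i; rewrite mem_index_enum => /(_ isT).
  by rewrite /signature if_same mul1r mulf_eq0 orbb => /eqP.
- move=> q; rewrite /sphere_space/= euclid_formE => qq.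
  have axis i : q 0 i ^+ 2 < r ^+ 2 -> exists u,
      wform (signature 1) q u = 0 /\ wform (signature 1) u u = 1.
    move=> h; apply: (@unit_tangent_of_axis _ _ r _ _ i).
    + by rewrite mulr1.
    + by rewrite gt_eqF.
    + by rewrite /signature if_same.
    + by rewrite mul1r.
    + by rewrite mul1r subr_gt0.
  (* At most one coordinate of [q] can have square [r ^+ 2], so one of the first
     two axes is not normal to the sphere at [q]. *)
  have [|q0] := ltP (q 0 ord0 ^+ 2) (r ^+ 2); first exact: axis.
  apply: (axis (lift ord0 ord0)); move: qq.
  rewrite wform_signature big_ord_recl mul1r.
  have : 0 <= \sum_(i < m) q 0 (lift ord0 (lift ord0 i)) * q 0 (lift ord0 (lift ord0 i)).
    by apply: sumr_ge0 => i _; rewrite -expr2 sqr_ge0.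
  have : 0 < r ^+ 2 by rewrite exprn_gt0.
  rewrite -!expr2; lra.
- exact: cos0.
- by move=> t; rewrite mulN1r; exact: is_derive_cos.
- by move=> t; exact: is_derive_sin.
- by move=> t; rewrite mul1r cos2Dsin2.
- by move=> t; right.
- by rewrite /= lexx pi_ge0.
- by move=> t /andP[].
- by move=> t; exact: sin_ge0_pi.
- move=> c s; rewrite mul1r => cs s0 _.
  have cB : -1 <= c <= 1.
    by rewrite -ler_norml -(@ler_pXn2r _ 2)// ?nnegrE// real_normK ?num_real// expr1n; have := sqr_ge0 s; lra.
  exists (acos c); split; first by rewrite /= acos_ge0// acos_lepi.
    by rewrite acosK.
  by rewrite sin_acos// -cs addrC addKr sqrtr_sqr ger0_norm.
- by move=> t; rewrite inE => t0; exact: cosK.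
- apply: (@continuous_subspaceW _ _ _ `[cos pi, cos 0]).
    by move=> _ [t _ <-] /=; rewrite in_itv/= cospi cos0 cos_geN1 cos_le1.
  apply: (segment_can_ge_continuous (pi_ge0 R)); last exact: cosK.
  exact/continuous_subspaceT/continuous_cos.
- move=> t tpi st; rewrite -[sin t]opprK invrN mulrNN mul1r.
  have tp : 0 < t < pi.
    case/andP: tpi => t0 t1; rewrite !lt_neqAle t0 t1 !andbT.
    apply/andP; split.
      by apply: contraTneq st => <-; rewrite sin0 ltxx.
    by apply: contraTneq st => ->; rewrite sinpi ltxx.
  have /near_in_itvoo aI : t \in `]0, pi[%R by rewrite in_itv/=.
  apply: (@is_derive_inverse R cos).
  + near=> z; apply: cosK.
    suff /itvP zI : z \in `]0, pi[%R by rewrite in_itv/= ?zI.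
    by near: z.
  + by near=> z; apply: continuous_cos.
  + by rewrite oppr_eq0 gt_eqF.
Unshelve. all: by end_near. Qed.

End Sphere.

Section HyperbolicFunctions.
Context {R : realType}.
Implicit Types t : R.

Definition cosh t : R := (expR t + expR (- t)) / 2.
Definition sinh t : R := (expR t - expR (- t)) / 2.
Definition arcosh t : R := ln (t + Num.sqrt (t ^+ 2 - 1)).

Let is_derive_expRN t : is_derive t 1 (fun t => expR (- t)) (- expR (- t)).
Proof.
have := @is_derive1_comp R expR -%R t _ _ (is_derive_expR (- t)) (is_deriveNid t 1).
by rewrite mulrN1.
Qed.

Lemma is_derive_cosh t : is_derive t 1 cosh (sinh t).
Proof.
have h := is_deriveZ (2^-1) (is_deriveD (is_derive_expR t) (is_derive_expRN t)).
rewrite (_ : cosh = 2^-1 \*: (expR + (fun t => expR (- t)))); last first.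
  by apply/funext => u; rewrite /cosh mulrC.
by apply: is_derive_eq h _; rewrite /sinh mulrC.
Qed.

Lemma is_derive_sinh t : is_derive t 1 sinh (cosh t).
Proof.
have h := is_deriveZ (2^-1) (is_deriveB (is_derive_expR t) (is_derive_expRN t)).
rewrite (_ : sinh = 2^-1 \*: (expR - (fun t => expR (- t)))); last first.
  by apply/funext => u; rewrite /sinh mulrC.
by apply: is_derive_eq h _; rewrite /cosh mulrC opprK.
Qed.

Lemma cosh2Bsinh2 t : cosh t ^+ 2 - sinh t ^+ 2 = 1.
Proof.
rewrite (_ : _ - _ = expR t * expR (- t)); last by rewrite /cosh /sinh; field.
exact: expRxMexpNx_1.
Qed.

Lemma cosh_gt0 t : 0 < cosh t.
Proof. by rewrite divr_gt0// addr_gt0// expR_gt0. Qed.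

Lemma sinh_gt0 t : 0 < t -> 0 < sinh t.
Proof.
by move=> t0; rewrite divr_gt0// subr_gt0 ltr_expR (lt_trans _ t0)// oppr_lt0.
Qed.

Lemma cosh0 : cosh 0 = 1.
Proof. by rewrite /cosh oppr0 expR0; field. Qed.

Lemma sinh0 : sinh 0 = 0.
Proof. by rewrite /sinh oppr0 subrr mul0r. Qed.

Lemma sinh_ge0 t : 0 <= t -> 0 <= sinh t.
Proof. by rewrite le_eqVlt => /predU1P[<-|/sinh_gt0/ltW//]; rewrite sinh0. Qed.

Lemma cosh_ge1 t : 1 <= cosh t.
Proof.
have := cosh2Bsinh2 t; have := cosh_gt0 t; have := sqr_ge0 (sinh t); nra.
Qed.

Lemma coshK t : 0 <= t -> arcosh (cosh t) = t.
Proof.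
move=> t0; rewrite /arcosh -(cosh2Bsinh2 t) subKr sqrtr_sqr ger0_norm ?sinh_ge0//.
by rewrite (_ : _ + _ = expR t) ?expRK// /cosh /sinh; field.
Qed.

Lemma arcosh_polar {c s : R} : c ^+ 2 - s ^+ 2 = 1 -> 0 <= s -> 0 < c ->
  [/\ 0 <= arcosh c, cosh (arcosh c) = c & sinh (arcosh c) = s].
Proof.
move=> cs s0 c0; have c1 : 1 <= c by nra.
have cs0 : 0 < c + s by lra.
have E : expR (arcosh c) = c + s.
  by rewrite /arcosh -cs subKr sqrtr_sqr ger0_norm// lnK.
have EN : expR (- arcosh c) = c - s.
  rewrite expRN E; apply: (mulfI (lt0r_neq0 cs0)).
  by rewrite divff ?lt0r_neq0// -cs; ring.
rewrite /cosh /sinh E EN; split; [|by field|by field].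
by apply: ln_ge0; have := sqrtr_ge0 (c ^+ 2 - 1); lra.
Qed.

Lemma continuous_arcosh (c : R) : 1 <= c -> {for c, continuous arcosh}.
Proof.
move=> c1; apply: (@continuous_comp _ _ _ (fun c : R => c + Num.sqrt (c ^+ 2 - 1)) (@ln R)).
  apply: cvgD; first exact: cvg_id.
  apply: (@continuous_comp _ _ _ (fun c : R => c ^+ 2 - 1) (@Num.sqrt R)).
    by apply: cvgB; [exact: exprn_continuous|exact: cvg_cst].
  exact: sqrt_continuous.
by apply: continuous_ln; have := sqrtr_ge0 (c ^+ 2 - 1); lra.
Qed.

Lemma is_derive_arcosh t : 0 < t -> is_derive (cosh t) 1 arcosh (sinh t)^-1.
Proof.
move=> t0; apply: (@is_derive_inverse R cosh).
- near=> z; apply: coshK; apply: ltW; near: z; exact: lt_nbhsr.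
- near=> z; apply: differentiable_continuous; apply/derivable1_diffP.
  by have [] := is_derive_cosh z.
- exact: is_derive_cosh.
- by rewrite gt_eqF// sinh_gt0.
Unshelve. all: by end_near. Qed.

Lemma cothE t : coth t = cosh t / sinh t.
Proof. by rewrite /coth /cosh /sinh invf_div mulrA divfK. Qed.

End HyperbolicFunctions.

Section Hyperbolic.
Context {R : realType} {m : nat} {r : R}.
Hypothesis r0 : 0 < r.
Local Notation V := 'rV[R]_m.+2.
Local Notation g := (wform (signature (-1))).

(** By Cauchy-Schwarz, as each spatial part is shorter than the time component.
    Hence the sign of [g p q] tells whether [p] and [q] are on the same sheet. *)
Lemma timelike_dominance {p q : V} : g p p = - r ^+ 2 -> g q q = - r ^+ 2 ->
  (\sum_(i < m.+1) p 0 (lift ord0 i) * q 0 (lift ord0 i)) ^+ 2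
    < (p 0 ord0 * q 0 ord0) ^+ 2.
Proof.
rewrite !wform_signature_sqr => pp qq; apply: le_lt_trans (sum_CauchySchwarz _ _) _.
have r2 : 0 < r ^+ 2 by rewrite exprn_gt0.
have X0 : 0 <= \sum_(i < m.+1) p 0 (lift ord0 i) ^+ 2.
  by apply: sumr_ge0 => i _; exact: sqr_ge0.
have Y0 : 0 <= \sum_(i < m.+1) q 0 (lift ord0 i) ^+ 2.
  by apply: sumr_ge0 => i _; exact: sqr_ge0.
move: pp qq X0 Y0; set X := \sum_i p _ _ ^+ 2; set Y := \sum_i q _ _ ^+ 2 => pp qq X0 Y0.
rewrite exprMn (_ : p 0 ord0 ^+ 2 = X + r ^+ 2); last by move: pp; lra.
rewrite (_ : q 0 ord0 ^+ 2 = Y + r ^+ 2); last by move: qq; lra.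
nra.
Qed.

Lemma hyperbolic_space_form :
  @space_form R m r (-1) (hyperbolic_space r) cosh sinh arcosh [set t | 0 <= t].
Proof.
have r2 : 0 < r ^+ 2 by rewrite exprn_gt0.
split.
- by right.
- move=> p q; rewrite /hyperbolic_space/= lorentz_formE mulN1r => -[qq q0].
  split=> [[pp p0]|[pp [|/eqP]]]; last first.
  + by rewrite eq_sym -subr_eq0 opprK -mulr2n pnatr_eq0.
  + move=> pq; split=> //; have := timelike_dominance pp qq; move: pq.
    rewrite wform_signature; set P := \sum_i _ => pq PP.
    rewrite ltNge; apply/negP => p0.
    have : p 0 ord0 * q 0 ord0 <= 0 by rewrite mulr_le0_ge0// ltW.
    nra.
  + split=> //; left; have := timelike_dominance pp qq.
    rewrite wform_signature; set P := \sum_i _ => PP.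
    have : 0 < p 0 ord0 * q 0 ord0 by rewrite mulr_gt0.
    nra.
- move=> q v; rewrite /hyperbolic_space/= lorentz_formE => -[qq q0].
  move: qq; rewrite !wform_signature_sqr wform_signature => qq qv v0.
  have := sum_CauchySchwarz (fun i => q 0 (lift ord0 i)) (fun i => v 0 (lift ord0 i)).
  have X0 : 0 <= \sum_(i < m.+1) v 0 (lift ord0 i) ^+ 2.
    by apply: sumr_ge0 => i _; exact: sqr_ge0.
  have Xn0 : v 0 ord0 = 0 -> \sum_(i < m.+1) v 0 (lift ord0 i) ^+ 2 != 0.
    move=> vt; apply: contraNneq v0 => /eqP; rewrite psumr_eq0 => [/allP vs|i _];
      last exact: sqr_ge0.
    apply/eqP/rowP => i; rewrite mxE; case: (unliftP ord0 i) => [j|] -> //.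
    by have := vs j; rewrite mem_index_enum sqrf_eq0 => /(_ isT)/eqP.
  move: qq qv X0 Xn0; set P := \sum_i _ * _; set Q := \sum_i q _ _ ^+ 2.
  set X := \sum_i v _ _ ^+ 2 => qq qv X0 Xn0 PQ.
  have Pq : P = q 0 ord0 * v 0 ord0 by move: qv; lra.
  have Qq : Q = q 0 ord0 ^+ 2 - r ^+ 2 by move: qq; lra.
  have {}X0 : 0 < X.
    rewrite lt0r X0 andbT; apply/negP => /eqP X0'.
    have /Xn0/eqP// : v 0 ord0 = 0.
    have : (q 0 ord0 * v 0 ord0) ^+ 2 == 0.
      by rewrite eq_le sqr_ge0 andbT -Pq -[leRHS](mulr0 Q) -X0'.
    by rewrite sqrf_eq0 mulf_eq0 gt_eqF//= => /eqP.
  move: PQ; rewrite Pq Qq => PQ.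
  have q2 : 0 < q 0 ord0 ^+ 2 by rewrite exprn_gt0.
  rewrite -(pmulr_rgt0 _ q2).
  have := mulr_gt0 r2 X0; lra.
- move=> q; rewrite /hyperbolic_space/= lorentz_formE => -[qq q0].
  apply: (@unit_tangent_of_axis _ _ r _ _ (lift ord0 ord0)).
  + by rewrite mulrNN mulr1.
  + by rewrite gt_eqF.
  + by [].
  + by rewrite mulN1r.
  + by rewrite mulN1r opprK ltr_pwDl// sqr_ge0.
- exact: cosh0.
- by move=> t; rewrite opprK mul1r; exact: is_derive_cosh.
- exact: is_derive_sinh.
- by move=> t; rewrite mulN1r cosh2Bsinh2.
- by move=> t; left; exact: cosh_gt0.
- by rewrite /=.
- by [].
- exact: sinh_ge0.
- move=> c s; rewrite mulN1r => cs s0 [c0|/eqP]; last first.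
    by rewrite eq_sym -subr_eq0 opprK -mulr2n pnatr_eq0.
  by exists (arcosh c); have [] := arcosh_polar cs s0 c0.
- by move=> t; rewrite inE/=; exact: coshK.
- apply: continuous_in_subspaceT => _ /set_mem[t _ <-].
  exact/continuous_arcosh/cosh_ge1.
- move=> t t0 st; rewrite opprK div1r; apply: is_derive_arcosh.
  by rewrite lt0r t0 andbT; apply: contraTneq st => ->; rewrite sinh0 ltxx.
Qed.

End Hyperbolic.

(** * Centers of geodesic spheres *)

Section SphereCenters.
Context {R : realType} {m : nat} {r : R}.
Hypothesis r0 : 0 < r.
Local Notation V := 'rV[R]_m.+2.
Local Notation M := (@sphere_space R m r).
Local Notation g := (@wform R m.+2 (signature 1)).

Let rn0 : r != 0. Proof. by rewrite gt_eqF. Qed.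

Lemma sphere_angle_itv (z0 : R) :
  0 <= z0 / r <= pi /\ sin (z0 / r) != 0 <-> 0 < z0 < pi * r.
Proof.
rewrite ler_pdivlMr// mul0r ler_pdivrMr//; split=> [[/andP[z1 z2] sz]|/andP[z1 z2]].
  rewrite !lt_neqAle z1 z2 !andbT; apply/andP; split.
    by apply: contraNneq sz => <-; rewrite mul0r sin0.
  by apply: contraNneq sz => ->; rewrite mulfK// sinpi.
split; first by rewrite !ltW.
by rewrite gt_eqF// sin_gt0_pi// divr_gt0//= ltr_pdivrMr.
Qed.

Lemma geodesic_sphereE {p q : V} {z0 : R} : M p -> 0 <= z0 / r <= pi ->
  geodesic_sphere g M p z0 q <-> M q /\ g p q = r ^+ 2 * cos (z0 / r).
Proof.
move=> Mp zB; split=> -[Mq].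
  by move=> /(riem_dist_eqP r0 (sphere_space_form r0) _ Mp Mq)[_]; rewrite mul1r.
move=> pq; split=> //; apply/(riem_dist_eqP r0 (sphere_space_form r0) _ Mp Mq).
by rewrite mul1r.
Qed.

Lemma half_angle_itv {z0 : R} : 0 < z0 < pi * r / 2 -> 0 < z0 / r < pi / 2.
Proof.
by move=> /andP[z0p z0r]; rewrite divr_gt0//= ltr_pdivrMr// mulrAC.
Qed.

(** Write [p'] in polar coordinates around [p], with angle [a] and direction [u].
    The two points of the first geodesic sphere in the directions [u] and [- u]
    have the same product with [p'], so [sin a = 0]; as both radii are below
    [pi * r / 2], this common product is positive, which excludes [p' = - p]. *)
Lemma sphere_center_unique {p p' : V} {z0 z0' : R} : M p -> M p' ->
  0 < z0 < pi * r / 2 -> 0 < z0' < pi * r / 2 ->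
  geodesic_sphere g M p z0 = geodesic_sphere g M p' z0' -> p = p'.
Proof.
move=> Mp Mp' /half_angle_itv; set t := z0 / r => /andP[t0 tpi].
move=> /half_angle_itv; set t' := z0' / r => /andP[t0' tpi'] E.
have pi2 : pi / 2 <= pi :> R by have := pi_ge0 R; lra.
have tB : 0 <= t <= pi by rewrite ltW//= ltW// (lt_le_trans tpi).
have tB' : 0 <= t' <= pi by rewrite ltW//= ltW// (lt_le_trans tpi').
have st : 0 < sin t by rewrite sin_gt0_pi// t0 (lt_le_trans tpi).
have ct : 0 < cos t by rewrite cos_gt0_pihalf// tpi andbT (lt_trans _ t0)// oppr_lt0 divr_gt0// pi_gt0.
have ct' : 0 < cos t' by rewrite cos_gt0_pihalf// tpi' andbT (lt_trans _ t0')// oppr_lt0 divr_gt0// pi_gt0.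
have [a [u [_ pu uu p'E]]] := polar_coordinates r0 (sphere_space_form r0) Mp Mp'.
have up : g u p = 0 by rewrite wformC.
have pp := space_norm (sphere_space_form r0) Mp.
have key (k : R) : k ^+ 2 = 1 ->
    cos t * (r ^+ 2 * cos a) + k * (r ^+ 2 * sin t * sin a) = r ^+ 2 * cos t'.
  move=> k1; pose q : V := cos t *: p + (k * (r * sin t)) *: u.
  have Mq : M q.
    rewrite /sphere_space/= euclid_formE !wformE pp pu up uu.
    rewrite [RHS](_ : _ = r ^+ 2 * (cos t ^+ 2 + k ^+ 2 * sin t ^+ 2)); first by ring.
    by rewrite k1 mul1r cos2Dsin2 mulr1.
  have : geodesic_sphere g M p z0 q.
    apply/(geodesic_sphereE Mp tB); split=> //.
    by rewrite !wformE pp pu; ring.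
  rewrite E => /(geodesic_sphereE Mp' tB')[_ <-].
  by rewrite p'E !wformE pp pu up uu; ring.
have k1 := key 1 (expr1n _ _); have kN := key (-1) (etrans (sqrrN 1) (expr1n _ _)).
have r2 : 0 < r ^+ 2 by rewrite exprn_gt0.
have sa : sin a = 0.
  apply/eqP; have /eqP : r ^+ 2 * sin t * sin a = 0 by lra.
  by rewrite mulf_eq0 gt_eqF ?mulr_gt0.
have ca : 0 < cos a.
  have : 0 < r ^+ 2 * cos t' by rewrite mulr_gt0.
  rewrite -k1 sa !mulr0 addr0 pmulr_rgt0// pmulr_rgt0//.
have c1 : cos a = 1.
  have := cos2Dsin2 a; rewrite sa expr0n addr0 => /eqP; rewrite sqrp_eq1 ?ltW//.
  by move/eqP.
by rewrite p'E c1 sa mulr0 scale0r addr0 scale1r.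
Qed.

Lemma sphere_antipodal_centers {p : V} : M p ->
  geodesic_sphere g M p (pi * r / 2) = geodesic_sphere g M (- p) (pi * r / 2).
Proof.
move=> Mp.
have Mp' : M (- p).
  by move: Mp; rewrite /sphere_space/= euclid_formE !wformE opprK.
have E : pi * r / 2 / r = pi / 2 by field.
have B : 0 <= pi * r / 2 / r <= pi by rewrite E; have := pi_ge0 R; lra.
apply/seteqP; split=> q.
  move=> /(geodesic_sphereE Mp B)[Mq pq]; apply/(geodesic_sphereE Mp' B); split=> //.
  by rewrite wformNl pq E cos_pihalf mulr0 oppr0.
move=> /(geodesic_sphereE Mp' B)[Mq pq]; apply/(geodesic_sphereE Mp B); split=> //.
by apply: oppr_inj; rewrite -wformNl pq E cos_pihalf mulr0 oppr0.
Qed.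

End SphereCenters.

(** * The characterization *)

Lemma sumsq_gt0 {R : realType} {m : nat} {a : 'I_m -> R} {f : 'I_m -> R} {x : R} :
  x != 0 -> \sum_(i < m) a i * f i + x = 0 -> 0 < \sum_(i < m) a i ^+ 2.
Proof.
move=> x0 E; rewrite lt0r sumr_ge0 ?andbT => [|i _]; last exact: sqr_ge0.
apply: contraNneq x0 => /eqP; rewrite psumr_eq0 => [/allP az|i _]; last exact: sqr_ge0.
rewrite -E big1 ?add0r// => i _; have := az i; rewrite mem_index_enum sqrf_eq0.
by move=> /(_ isT)/eqP ->; rewrite mul0r.
Qed.

Theorem theorem3 (R : realType) (m : nat) (r : R) (r_gt0 : 0 < r)
    (I : set R) (I_itv : nondegenerate_interval I)
    (alpha : R -> 'rV[R]_(m.+2)) (n : 'I_m -> R -> 'rV[R]_(m.+2))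
    (kappa : 'I_m -> R -> R) :
  [/\ (* alpha in the sphere of radius r *)
      arc_length_curve (@euclid_form R m) (sphere_space r) I alpha ->
      RM_frame (@euclid_form R m) I alpha n ->
      RM_curvatures (@euclid_form R m) I alpha n kappa ->
      [/\ (* z0 is the radius, a is normalized *)
          forall z0 : R,
            lies_on_geodesic_sphere (@euclid_form R m) (sphere_space r) I alpha z0 <->
            exists a : 'I_m -> R,
              [/\ 0 < z0 < pi * r, \sum_(i < m) a i ^+ 2 = 1
                & forall s, I s ->
                    \sum_(i < m) a i * kappa i s + r^-1 * cot (z0 / r) = 0],
          (* arbitrary constants, not all a_i zero *)
          (exists z0 : R,
            lies_on_geodesic_sphere (@euclid_form R m) (sphere_space r) I alpha z0) <->
          (exists (z0 : R) (a : 'I_m -> R),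
              [/\ 0 < z0 < pi * r, exists i, a i <> 0
                & forall s, I s ->
                    \sum_(i < m) a i * kappa i s + r^-1 * cot (z0 / r) = 0])
        & (* arbitrary constants, z0 < pi r / 2 *)
          (exists2 z0 : R, z0 < pi * r / 2 &
            lies_on_geodesic_sphere (@euclid_form R m) (sphere_space r) I alpha z0) <->
          (exists (z0 : R) (a : 'I_m -> R),
              0 < z0 < pi * r / 2 /\
              forall s, I s ->
                \sum_(i < m) a i * kappa i s + r^-1 * cot (z0 / r) = 0)],
      (* the center is well defined if z0 < pi r / 2 *)
      forall (p p' : 'rV[R]_(m.+2)) (z0 z0' : R),
        sphere_space r p -> sphere_space r p' ->
        0 < z0 < pi * r / 2 -> 0 < z0' < pi * r / 2 ->
        geodesic_sphere (@euclid_form R m) (sphere_space r) p z0 =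
          geodesic_sphere (@euclid_form R m) (sphere_space r) p' z0' ->
        p = p',
      (* if z0 = pi r / 2, then p and -p are both centers *)
      forall p : 'rV[R]_(m.+2), sphere_space r p ->
        geodesic_sphere (@euclid_form R m) (sphere_space r) p (pi * r / 2) =
        geodesic_sphere (@euclid_form R m) (sphere_space r) (- p) (pi * r / 2)
    & (* alpha in the hyperbolic space of radius r *)
      arc_length_curve (@lorentz_form R m) (hyperbolic_space r) I alpha ->
      RM_frame (@lorentz_form R m) I alpha n ->
      RM_curvatures (@lorentz_form R m) I alpha n kappa ->
      (* z0 is the radius, a is normalized *)
      (forall z0 : R,
         lies_on_geodesic_sphere (@lorentz_form R m) (hyperbolic_space r) I alpha z0 <->
         exists a : 'I_m -> R,
           [/\ 0 < z0, \sum_(i < m) a i ^+ 2 = 1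
             & forall s, I s ->
                 \sum_(i < m) a i * kappa i s + r^-1 * coth (z0 / r) = 0]) /\
      (* arbitrary constants with |a| < coth (z0 / r) *)
      ((exists z0 : R,
         lies_on_geodesic_sphere (@lorentz_form R m) (hyperbolic_space r) I alpha z0) <->
       (exists (z0 : R) (a : 'I_m -> R),
           [/\ 0 < z0, \sum_(i < m) a i ^+ 2 < coth (z0 / r) ^+ 2
             & forall s, I s ->
                 \sum_(i < m) a i * kappa i s + r^-1 * coth (z0 / r) = 0]))].
Proof.
have rn0 : r != 0 by rewrite gt_eqF.
have r0 := r_gt0; have sS := sphere_space_form (m := m) r0.
have sH := hyperbolic_space_form (m := m) r0.
rewrite euclid_formE lorentz_formE; split.
- move=> curve frame curvatures.
  have P z0 := lies_on_geodesic_sphereP r0 sS I_itv curve frame curvatures z0.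
  have P1 z0 : lies_on_geodesic_sphere (wform (signature 1)) (sphere_space r) I alpha z0 <->
      exists a : 'I_m -> R, [/\ 0 < z0 < pi * r, \sum_(i < m) a i ^+ 2 = 1
        & forall s, I s -> \sum_(i < m) a i * kappa i s + r^-1 * cot (z0 / r) = 0].
    split=> [/P[zB s0 [a [a1 ak]]]|[a [zB a1 ak]]].
      by exists a; split=> //; apply/(sphere_angle_itv r0).
    have [tB s0] := (sphere_angle_itv r0 z0).2 zB.
    by apply/P; split=> //; exists a.
  have [s0 Is0] : exists s, I s by case: I_itv => _ [s [_ [Is _ _]]]; exists s.
  split; first exact: P1.
  + split=> [[z0 /P1[a [zB a1 ak]]]|[z0 [a [zB [i ai] ak]]]].
      exists z0, a; split=> //; apply: contrapT => an.
      have := oner_neq0 R; rewrite -a1 big1 ?eqxx// => i _.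
      by apply/eqP; rewrite sqrf_eq0; apply/negPn/negP => /eqP ai; apply: an; exists i.
    have a2 : 0 < \sum_(i < m) a i ^+ 2.
      rewrite (bigD1 i)//= ltr_pwDl ?exprn_even_gt0//=; first exact/eqP.
      by apply: sumr_ge0 => j _; exact: sqr_ge0.
    have [||z [? _ _]] := relation_on_geodesic_sphere r0 sS I_itv curve frame curvatures a2 _ _ ak.
    * by rewrite mul1r ltr_wpDl ?sqr_ge0.
    * by right.
    * by exists z.
  + (* Here [a] cannot vanish, since the cotangent is positive. *)
    split=> [[z0 z0r /P1[a [/andP[z00 _] a1 ak]]]|[z0 [a [zB ak]]]].
      by exists z0, a; rewrite z00 z0r.
    have /andP[t0 tpi] := half_angle_itv r0 zB.
    have cot0 : 0 < cot (z0 / r).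
      rewrite divr_gt0//.
        by rewrite cos_gt0_pihalf// tpi andbT (lt_trans _ t0)// oppr_lt0 divr_gt0// pi_gt0.
      by rewrite sin_gt0_pihalf// t0.
    have a2 : 0 < \sum_(i < m) a i ^+ 2.
      by apply: sumsq_gt0 (ak s0 Is0); rewrite mulf_neq0 ?invr_eq0// gt_eqF.
    have [||z [zl tB /(_ cot0) cz]] :=
        relation_on_geodesic_sphere r0 sS I_itv curve frame curvatures a2 _ _ ak.
    * by rewrite mul1r ltr_wpDl ?sqr_ge0.
    * by right.
    * exists z => //; rewrite mulrAC -ltr_pdivrMr//.
      by rewrite -ltr_cos ?cos_pihalf// in_itv//=; have := pi_ge0 R; lra.
- move=> p p' z0 z0' Mp Mp' zB zB'; exact: sphere_center_unique.
- by move=> p Mp; exact: sphere_antipodal_centers.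
- move=> curve frame curvatures.
  have P z0 := lies_on_geodesic_sphereP r0 sH I_itv curve frame curvatures z0.
  have P1 z0 : lies_on_geodesic_sphere (wform (signature (-1))) (hyperbolic_space r) I alpha z0 <->
      exists a : 'I_m -> R, [/\ 0 < z0, \sum_(i < m) a i ^+ 2 = 1
        & forall s, I s -> \sum_(i < m) a i * kappa i s + r^-1 * coth (z0 / r) = 0].
    split=> [/P[/= zB s0 [a [a1 ak]]]|[a [z00 a1 ak]]].
      exists a; split=> //; last by move=> s /ak; rewrite cothE.
      move: zB; rewrite ler_pdivlMr// mul0r le_eqVlt => /predU1P[z00|//].
      by move: s0; rewrite -z00 mul0r sinh0 eqxx.
    apply/P; split; first by rewrite /= divr_ge0// ltW.
      by rewrite gt_eqF// sinh_gt0// divr_gt0.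
    by exists a; split=> // s /ak; rewrite cothE.
  have [s0 Is0] : exists s, I s by case: I_itv => _ [s [_ [Is _ _]]]; exists s.
  split; first exact: P1.
  split=> [[z0 /P1[a [z00 a1 ak]]]|[z0 [a [z00 ac ak]]]].
    exists z0, a; split=> //; rewrite a1 cothE expr_div_n.
    have s2 : 0 < sinh (z0 / r) ^+ 2 by rewrite exprn_gt0// sinh_gt0// divr_gt0.
    by rewrite ltr_pdivlMr// mul1r -subr_gt0 cosh2Bsinh2.
  have coth0 : 0 < coth (z0 / r).
    by rewrite cothE divr_gt0 ?cosh_gt0// sinh_gt0// divr_gt0.
  have a2 : 0 < \sum_(i < m) a i ^+ 2.
    by apply: sumsq_gt0 (ak s0 Is0); rewrite mulf_neq0 ?invr_eq0// gt_eqF.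
  have [||z [zl _ _]] :=
      relation_on_geodesic_sphere r0 sH I_itv curve frame curvatures a2 _ _ ak.
  * by rewrite mulN1r subr_gt0.
  * by left.
  * by exists z.
Qed.
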